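(* Suppose that $\mathbf u_t\mid\mathcal F_{t-1}$ is mean zero and $1$-subgaussian. Then: (a) For any fixed $\delta\in(0,1)$ and positive definite $V_0\in\mathbb R^{m\times m}$, with probability at least $1-\delta$, \[ \|(\boldsymbol\Delta^\top\boldsymbol\Delta+V_0)^{-1/2}\boldsymbol\Delta^\top\bar{\mathbf U}\|_{\mathrm{op}}\lesssim T^{1/2}\sqrt{\tilde p+\log\tfrac1\delta+\log\det(I+\boldsymbol\Delta V_0^{-1}\boldsymbol\Delta^\top)^{1/2}}. \] (b) For any fixed $\delta\in(0,1)$ and $\kappa>0$, with probability at least $1-\delta$, \[ \sigma_{\min}(\bar{\mathbf U})^2\|\bar{\mathbf U}^\dagger\boldsymbol\Delta\|_{\mathrm{op}}\le\|\boldsymbol\Delta^\top\bar{\mathbf U}\|_{\mathrm{op}}\lesssim T^{1/2}(\|\boldsymbol\Delta\|_{\mathrm{op}}+\kappa)\sqrt{\tilde p+m+\log\tfrac1\delta+\mathrm{lil}\big(\|\boldsymbol\Delta\|_{\mathrm{op}}/\kappa\big)}, \] where here $\mathrm{lil}(x):=\log(1+\log(1+x))$.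
   Context: Integers $p,m,T\ge1$, $1\le N_1\le N$. $\{\mathcal F_t\}$ is a filtration; $\mathbf u_t\in\mathbb R^p$ is $\mathcal F_t$-measurable; $1$-subgaussian means $\mathbb E[\exp(\langle v,\mathbf u_t\rangle)\mid\mathcal F_{t-1}]\le\exp(\|v\|_2^2/2)$ for all $v$. $\bar{\mathbf u}_t:=[\mathbf u_t^\top|\dots|\mathbf u_{t-T+1}^\top]^\top\in\mathbb R^{Tp}$. $\boldsymbol\delta_t\in\mathbb R^m$ is $\mathcal F_{t-T}$-measurable (semi-parametric model $\mathbf y_t=G_\star\bar{\mathbf u}_t+\boldsymbol\delta_t$). $\bar{\mathbf U}$ and $\boldsymbol\Delta$ are the matrices with rows $\bar{\mathbf u}_t^\top$, resp. $\boldsymbol\delta_t^\top$, $t=N_1,\dots,N$. $\tilde p:=p\min\{T,\log^2(eTp)\log^2(Tp)\}$. $\lesssim$ hides universal constants. *)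

(* Defs.v *)
From HB Require Import structures.
From mathcomp Require Import all_boot all_order all_algebra.
From mathcomp Require Import all_classical all_reals all_analysis.
Set Implicit Arguments. Unset Strict Implicit. Unset Printing Implicit Defensive.
Import Order.TTheory GRing.Theory Num.Theory.
Local Open Scope classical_set_scope.
Local Open Scope ring_scope.

Section LinAlg.
Variable R : realType.

Definition mx_norm2 (n : nat) (x : 'cV[R]_n) : R :=
  Num.sqrt (\sum_(i < n) x i 0 ^+ 2).

Definition mx_opnorm (a b : nat) (A : 'M[R]_(a, b)) : R :=
  sup [set mx_norm2 (A *m x) | x in [set x : 'cV[R]_b | mx_norm2 x <= 1]].

(** Smallest singular value of A (a x b): inf_{||x||_2 = 1} ||A x||_2,
    i.e. sqrt(lambda_min(A^T A)). *)
Definition mx_sigma_min (a b : nat) (A : 'M[R]_(a, b)) : R :=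
  inf [set mx_norm2 (A *m x) | x in [set x : 'cV[R]_b | mx_norm2 x = 1]].

Definition mx_symmetric (n : nat) (M : 'M[R]_n) : Prop := M^T = M.

Definition mx_psd (n : nat) (M : 'M[R]_n) : Prop :=
  mx_symmetric M /\ forall x : 'cV[R]_n, 0 <= (x^T *m M *m x) 0 0.

Definition mx_posdef (n : nat) (M : 'M[R]_n) : Prop :=
  mx_symmetric M /\ forall x : 'cV[R]_n, x != 0 -> 0 < (x^T *m M *m x) 0 0.

(** The positive semidefinite square root M^{1/2} (unique for mx_psd M). *)
Definition mx_sqrtm (n : nat) (M : 'M[R]_n) : 'M[R]_n :=
  xget 0 [set S | mx_psd S /\ S *m S = M].

Definition mx_pinv (a b : nat) (A : 'M[R]_(a, b)) : 'M[R]_(b, a) :=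
  xget 0 [set X | [/\ A *m X *m A = A, X *m A *m X = X,
                      (A *m X)^T = A *m X & (X *m A)^T = X *m A]].

Definition lil (x : R) : R := ln (1 + ln (1 + x)).

Definition ptilde (p T : nat) : R :=
  p%:R * Num.min (T%:R)
    (ln (expR 1 * (T * p)%:R) ^+ 2 * ln ((T * p)%:R) ^+ 2).

End LinAlg.

Section Prob.
Context {R : realType} {d : measure_display} {Omega : measurableType d}.

Definition measurable_wrt (G : set (set Omega)) (f : Omega -> R) : Prop :=
  forall B : set R, measurable B -> G (f @^-1` B).

Definition filtration (F : int -> set (set Omega)) : Prop :=
  (forall t, sigma_algebra setT (F t)) /\
  (forall t, F t `<=` measurable) /\
  (forall s t, (s <= t)%R -> F s `<=` F t).

(** Row vector bar u_t^T = [u_t^T | u_{t-1}^T | ... | u_{t-T+1}^T] in R^{Tp}. *)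
Definition ubar_row (p T : nat) (u : int -> Omega -> 'cV[R]_p) (t : int)
  (w : Omega) : 'rV[R]_(T * p) :=
  mxvec (\matrix_(k < T, l < p) u (t - k%:Z)%R w l 0).

(** The data matrices bar U and Delta, rows indexed by t = N1, ..., N. *)
Definition Ubar (p T N1 N : nat) (u : int -> Omega -> 'cV[R]_p) (w : Omega)
  : 'M[R]_((N - N1).+1, T * p) :=
  \matrix_(i < (N - N1).+1, j < T * p)
     @ubar_row p T u (N1%:Z + i%:Z)%R w 0 j.

Definition Delta (m N1 N : nat) (dl : int -> Omega -> 'cV[R]_m) (w : Omega)
  : 'M[R]_((N - N1).+1, m) :=
  \matrix_(i < (N - N1).+1, j < m) dl (N1%:Z + i%:Z)%R w j 0.

End Prob.

Arguments ubar_row {R d Omega} p T u t w.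
Arguments Ubar {R d Omega} p T N1 N u w.
Arguments Delta {R d Omega} m N1 N dl w.
Arguments ptilde {R} p T.
Arguments lil {R} x.

(* Main.v *)
Require Import Defs.
From HB Require Import structures.
From mathcomp Require Import all_boot all_order all_algebra.
From mathcomp Require Import all_classical all_reals all_analysis.
From mathcomp Require Import finmap measurable_realfun zify ring lra.
Set Implicit Arguments. Unset Strict Implicit. Unset Printing Implicit Defensive.
Import Order.TTheory GRing.Theory Num.Theory.
Local Open Scope classical_set_scope.
Local Open Scope ring_scope.

(** For [Y_k := V^(-1/2) D^T U_k], with [U_k] the lag-[k] block of [U], the
    operator norm of [[Y_0 | ... | Y_(T-1)]] is at most the square root of
    [sum_k |Y_k|^2], so the factor [T^(1/2)] lets the lags be treated one at a
    time, and neither chaining nor a net of dimension [T p] is needed.  For a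
    fixed lag and a fixed direction [z], the sum [sum_t delta_t <z, u_(t-k)>] is
    a martingale transform since [delta_t] is [F_(t-T)]-measurable, and
    [exp (|V_t^(-1/2) S_t|^2 / 2) / sqrt (det V_t / det V_0)] is a
    supermartingale: by the Sherman-Morrison formula each increment reduces to a
    one-dimensional Gaussian mixture.  A net of cardinality [exp (O(p))] of the
    unit ball of [R^p] handles the directions, and Jensen's inequality over the
    lags together with Markov's inequality gives (a).  For (b) one takes
    [V_0 = (kappa 2^j)^2 I] with confidence [delta / ((j+1)(j+2))] for all [j]
    and uses the dyadic scale of [|D|]. *)

Section EuclideanNorm.
Variable R : realType.
Implicit Types a b n : nat.

Lemma mx_norm2_ge0 n (x : 'cV[R]_n) : 0 <= mx_norm2 x.
Proof. exact: sqrtr_ge0. Qed.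

Lemma mx_norm2_sqr n (x : 'cV[R]_n) : mx_norm2 x ^+ 2 = \sum_(i < n) x i 0 ^+ 2.
Proof. by rewrite sqr_sqrtr// sumr_ge0// => i _; exact: sqr_ge0. Qed.

Lemma dotmxE n (x y : 'cV[R]_n) : (x^T *m y) 0 0 = \sum_(i < n) x i 0 * y i 0.
Proof. by rewrite mxE; apply: eq_bigr => i _; rewrite mxE. Qed.

Lemma mx_norm2_dot n (x : 'cV[R]_n) : mx_norm2 x ^+ 2 = (x^T *m x) 0 0.
Proof. by rewrite mx_norm2_sqr dotmxE; apply: eq_bigr => i _; rewrite expr2. Qed.

Lemma mx_norm2_0 n : mx_norm2 (0 : 'cV[R]_n) = 0.
Proof.
rewrite /mx_norm2 big1 ?sqrtr0// => i _; by rewrite mxE expr0n.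
Qed.

Lemma mx_norm2_eq0 n (x : 'cV[R]_n) : (mx_norm2 x == 0) = (x == 0).
Proof.
apply/idP/eqP => [|->]; last by rewrite mx_norm2_0.
rewrite -sqrf_eq0 mx_norm2_sqr psumr_eq0; last by move=> i _; exact: sqr_ge0.
move=> /allP h; apply/matrixP => i j; rewrite ord1 mxE.
have := h i; rewrite mem_index_enum => /(_ isT) /=.
by rewrite sqrf_eq0 => /eqP.
Qed.

Lemma mx_norm2Z n (c : R) (x : 'cV[R]_n) : mx_norm2 (c *: x) = `|c| * mx_norm2 x.
Proof.
rewrite -sqrtr_sqr -sqrtrM ?sqr_ge0//; congr Num.sqrt.
by rewrite mulr_sumr; apply: eq_bigr => i _; rewrite mxE exprMn.
Qed.

Lemma cauchy_schwarz_sqr (I : finType) (f g : I -> R) :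
  (\sum_i f i * g i) ^+ 2 <= (\sum_i f i ^+ 2) * (\sum_i g i ^+ 2).
Proof.
set a := \sum_i f i ^+ 2; set b := \sum_i g i ^+ 2; set c := \sum_i _.
have b0 : 0 <= b by apply: sumr_ge0 => i _; exact: sqr_ge0.
have [bz|bnz] := eqVneq b 0.
  have gz i : g i = 0.
    move: bz => /eqP; rewrite /b psumr_eq0; last by move=> j _; exact: sqr_ge0.
    move=> /allP /(_ i); rewrite mem_index_enum => /(_ isT) /=.
    by rewrite sqrf_eq0 => /eqP.
  rewrite bz mulr0 /c big1 ?expr0n// => i _; by rewrite gz mulr0.
have bp : 0 < b by rewrite lt_def bnz.
have : 0 <= \sum_i (b * f i - c * g i) ^+ 2.
  by apply: sumr_ge0 => i _; exact: sqr_ge0.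
have -> : \sum_i (b * f i - c * g i) ^+ 2 = b * (a * b - c ^+ 2).
  have -> : b * (a * b - c ^+ 2) = b ^+ 2 * a - 2 * b * c * c + c ^+ 2 * b by ring.
  have -> : b ^+ 2 * a = \sum_i b ^+ 2 * f i ^+ 2 by rewrite mulr_sumr.
  have -> : 2 * b * c * c = \sum_i 2 * b * c * (f i * g i) by rewrite -mulr_sumr.
  have -> : c ^+ 2 * b = \sum_i c ^+ 2 * g i ^+ 2 by rewrite -mulr_sumr.
  rewrite -sumrB -big_split /=.
  by apply: eq_bigr => i _; ring.
by rewrite pmulr_rge0// subr_ge0.
Qed.

Lemma cauchy_schwarz_sum (I : finType) (f g : I -> R) :
  \sum_i f i * g i <= Num.sqrt (\sum_i f i ^+ 2) * Num.sqrt (\sum_i g i ^+ 2).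
Proof.
rewrite -sqrtrM; last by apply: sumr_ge0 => i _; exact: sqr_ge0.
apply: (le_trans (ler_norm _)); rewrite -sqrtr_sqr.
by rewrite ler_wsqrtr// cauchy_schwarz_sqr.
Qed.

Lemma cauchy_schwarz_mx n (x y : 'cV[R]_n) :
  (x^T *m y) 0 0 <= mx_norm2 x * mx_norm2 y.
Proof. by rewrite dotmxE; exact: cauchy_schwarz_sum. Qed.

Lemma ler_mx_norm2D n (x y : 'cV[R]_n) :
  mx_norm2 (x + y) <= mx_norm2 x + mx_norm2 y.
Proof.
rewrite -(@ler_pXn2r _ 2)// ?nnegrE ?addr_ge0 ?mx_norm2_ge0//.
have -> : mx_norm2 (x + y) ^+ 2 =
    mx_norm2 x ^+ 2 + 2 * (x^T *m y) 0 0 + mx_norm2 y ^+ 2.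
  rewrite !mx_norm2_sqr dotmxE mulr_sumr -!big_split /=.
  by apply: eq_bigr => i _; rewrite mxE; ring.
by have := cauchy_schwarz_mx x y; lra.
Qed.

Lemma ler_mx_norm2_sum n (I : Type) (r : seq I) (x : I -> 'cV[R]_n) :
  mx_norm2 (\sum_(i <- r) x i) <= \sum_(i <- r) mx_norm2 (x i).
Proof.
elim/big_rec2: _ => [|i y1 y2 _ h]; first by rewrite mx_norm2_0.
by apply: (le_trans (ler_mx_norm2D _ _)); rewrite lerD2l.
Qed.

Lemma mx_opnorm_has_sup a b (A : 'M[R]_(a, b)) :
  has_sup [set mx_norm2 (A *m x) | x in [set x : 'cV[R]_b | mx_norm2 x <= 1]].
Proof.
split; first by exists (mx_norm2 (A *m 0)); exists 0 => //=; rewrite mx_norm2_0.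
exists (Num.sqrt (\sum_i \sum_j A i j ^+ 2)) => _ [x /= x1 <-].
apply: ler_wsqrtr; apply: ler_sum => i _; rewrite mxE.
apply: (le_trans (cauchy_schwarz_sqr _ _)).
rewrite ler_piMr//; first by apply: sumr_ge0 => j _; exact: sqr_ge0.
by rewrite -mx_norm2_sqr expr_le1// mx_norm2_ge0.
Qed.

Lemma mx_opnorm_ge0 a b (A : 'M[R]_(a, b)) : 0 <= mx_opnorm A.
Proof.
apply: (le_trans (mx_norm2_ge0 (A *m 0))).
apply: sup_upper_bound; first exact: mx_opnorm_has_sup.
by exists 0 => //=; rewrite mx_norm2_0.
Qed.

Lemma mx_opnorm_ub a b (A : 'M[R]_(a, b)) (x : 'cV[R]_b) :
  mx_norm2 (A *m x) <= mx_opnorm A * mx_norm2 x.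
Proof.
have [->|x0] := eqVneq x 0; first by rewrite mulmx0 !mx_norm2_0 mulr0.
have xp : 0 < mx_norm2 x by rewrite lt_def mx_norm2_eq0 x0 mx_norm2_ge0.
rewrite -ler_pdivrMr//.
have -> : mx_norm2 (A *m x) / mx_norm2 x = mx_norm2 (A *m ((mx_norm2 x)^-1 *: x)).
  by rewrite -scalemxAr mx_norm2Z ger0_norm ?invr_ge0 ?mx_norm2_ge0// mulrC.
apply: sup_upper_bound; first exact: mx_opnorm_has_sup.
exists ((mx_norm2 x)^-1 *: x) => //=.
by rewrite mx_norm2Z ger0_norm ?invr_ge0 ?mx_norm2_ge0// mulVf// gt_eqF.
Qed.

Lemma mx_opnorm_le a b (A : 'M[R]_(a, b)) (c : R) :
  (forall x, mx_norm2 x <= 1 -> mx_norm2 (A *m x) <= c) -> mx_opnorm A <= c.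
Proof.
move=> h; apply: ge_sup; first exact: (mx_opnorm_has_sup A).1.
by move=> _ [x /= x1 <-]; exact: h.
Qed.

Lemma mx_opnorm_leP a b (A : 'M[R]_(a, b)) (c : R) : 0 <= c ->
  (forall x, mx_norm2 (A *m x) <= c * mx_norm2 x) -> mx_opnorm A <= c.
Proof.
by move=> c0 h; apply: mx_opnorm_le => x x1; apply: (le_trans (h x)); rewrite ler_piMr.
Qed.

Lemma mx_opnorm_trmx_le a b (A : 'M[R]_(a, b)) : mx_opnorm A^T <= mx_opnorm A.
Proof.
apply: mx_opnorm_leP => [|x]; first exact: mx_opnorm_ge0.
have [h|h] := leP (mx_norm2 (A^T *m x)) 0.
  by apply: (le_trans h); rewrite mulr_ge0 ?mx_opnorm_ge0 ?mx_norm2_ge0.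
rewrite -(ler_pM2l h) -expr2 mx_norm2_dot trmx_mul trmxK -mulmxA.
apply: (le_trans (cauchy_schwarz_mx _ _)).
apply: (le_trans (ler_wpM2l (mx_norm2_ge0 x) (mx_opnorm_ub A _))).
by rewrite mulrA mulrC [mx_norm2 x * _]mulrC.
Qed.

Lemma mx_opnorm_trmx a b (A : 'M[R]_(a, b)) : mx_opnorm A^T = mx_opnorm A.
Proof.
apply/eqP; rewrite eq_le mx_opnorm_trmx_le -[X in mx_opnorm X <= _]trmxK.
exact: mx_opnorm_trmx_le.
Qed.

Lemma mx_opnormM a b c (A : 'M[R]_(a, b)) (B : 'M[R]_(b, c)) :
  mx_opnorm (A *m B) <= mx_opnorm A * mx_opnorm B.
Proof.
apply: mx_opnorm_leP => [|x]; first by rewrite mulr_ge0 ?mx_opnorm_ge0.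
rewrite -mulmxA; apply: (le_trans (mx_opnorm_ub _ _)).
by rewrite -mulrA ler_wpM2l ?mx_opnorm_ge0// mx_opnorm_ub.
Qed.

Lemma mx_sigma_min_ge0 a b (A : 'M[R]_(a, b)) : 0 <= mx_sigma_min A.
Proof.
rewrite /mx_sigma_min; set S := [set _ | _ in _].
have [->|S0] := eqVneq S set0; first by rewrite inf0.
by apply: lb_le_inf; [exact/set0P|move=> _ [x _ <-]; exact: mx_norm2_ge0].
Qed.

Lemma mx_sigma_min_lb a b (A : 'M[R]_(a, b)) (x : 'cV[R]_b) :
  mx_sigma_min A * mx_norm2 x <= mx_norm2 (A *m x).
Proof.
have [->|x0] := eqVneq x 0; first by rewrite mulmx0 !mx_norm2_0 mulr0.
have xp : 0 < mx_norm2 x by rewrite lt_def mx_norm2_eq0 x0 mx_norm2_ge0.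
rewrite -ler_pdivlMr//.
have -> : mx_norm2 (A *m x) / mx_norm2 x = mx_norm2 (A *m ((mx_norm2 x)^-1 *: x)).
  by rewrite -scalemxAr mx_norm2Z ger0_norm ?invr_ge0 ?mx_norm2_ge0// mulrC.
apply: ge_inf.
  by exists 0 => _ [y _ <-]; exact: mx_norm2_ge0.
exists ((mx_norm2 x)^-1 *: x) => //=.
by rewrite mx_norm2Z ger0_norm ?invr_ge0 ?mx_norm2_ge0// mulVf// gt_eqF.
Qed.

(* With [x = U^+ D y], the Moore-Penrose equations give [|U x|^2 = x^T U^T D y]. *)
Lemma mx_pinv_bound n a b (U : 'M[R]_(n, a)) (D : 'M[R]_(n, b)) :
  mx_sigma_min U ^+ 2 * mx_opnorm (mx_pinv U *m D) <= mx_opnorm (D^T *m U).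
Proof.
rewrite /mx_pinv; case: xgetP => [X _ [UXU _ UXsym _]|_]; last first.
  have -> : mx_opnorm ((0 : 'M[R]_(a, n)) *m D) = 0.
    apply/eqP; rewrite eq_le mx_opnorm_ge0 andbT; apply: mx_opnorm_le => x _.
    by rewrite mul0mx mul0mx mx_norm2_0.
  by rewrite mulr0 mx_opnorm_ge0.
have s0 := mx_sigma_min_ge0 U.
have [->|sn0] := eqVneq (mx_sigma_min U) 0.
  by rewrite expr0n mul0r mx_opnorm_ge0.
have sp : 0 < mx_sigma_min U ^+ 2 by rewrite exprn_gt0// lt_def sn0.
rewrite mulrC -ler_pdivlMr//; apply: mx_opnorm_leP => [|y].
  by rewrite divr_ge0 ?mx_opnorm_ge0 ?sqr_ge0.
set x := _ *m y.
have Ux : mx_norm2 (U *m x) ^+ 2 = (x^T *m (U^T *m D *m y)) 0 0.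
  rewrite mx_norm2_dot trmx_mul -!mulmxA; congr ((_ *m _) 0 0).
  rewrite /x !mulmxA; congr (_ *m _ *m _).
  by rewrite -mulmxA -UXsym -trmx_mul UXU.
have [x0|x0] := leP (mx_norm2 x) 0.
  by apply: (le_trans x0); rewrite mulr_ge0 ?divr_ge0 ?mx_opnorm_ge0 ?mx_norm2_ge0 ?sqr_ge0.
rewrite mulrAC ler_pdivlMr// mulrC -(ler_pM2r x0) -mulrA -expr2 -exprMn.
apply: (@le_trans _ _ (mx_norm2 (U *m x) ^+ 2)).
  by rewrite lerXn2r ?nnegrE ?mulr_ge0 ?mx_norm2_ge0// mx_sigma_min_lb.
rewrite Ux; apply: (le_trans (cauchy_schwarz_mx _ _)).
rewrite mulrC ler_wpM2r ?mx_norm2_ge0//.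
have -> : D^T *m U = (U^T *m D)^T by rewrite trmx_mul trmxK.
by rewrite mx_opnorm_trmx mx_opnorm_ub.
Qed.

End EuclideanNorm.

Section PositiveDefinite.
Variable R : realType.
Implicit Types m n : nat.

Lemma mx_posdef_unit m (V : 'M[R]_m) : mx_posdef V -> V \in unitmx.
Proof.
move=> [_ V0]; rewrite unitmxE unitfE; apply/det0P => -[v v0 vV].
have := V0 v^T; rewrite trmx_eq0 => /(_ v0).
by rewrite trmxK vV mul0mx mxE ltxx.
Qed.

Lemma mx_posdefD_gram m n (V : 'M[R]_m) (D : 'M[R]_(n, m)) :
  mx_posdef V -> mx_posdef (V + D^T *m D).
Proof.
move=> [Vs V0]; split.
  by rewrite /mx_symmetric raddfD /= trmx_mul trmxK Vs.
move=> x x0; rewrite mulmxDr mulmxDl mxE ltr_wpDr ?V0//.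
by rewrite !mulmxA -mulmxA -trmx_mul -mx_norm2_dot sqr_ge0.
Qed.

Lemma mx_posdef_inv m (V : 'M[R]_m) : mx_posdef V -> mx_posdef (invmx V).
Proof.
move=> Vp; have Vu := mx_posdef_unit Vp; case: Vp => Vs V0.
have Qs : (invmx V)^T = invmx V by rewrite trmx_inv Vs.
split => // x x0.
have -> : x^T *m invmx V *m x = (invmx V *m x)^T *m V *m (invmx V *m x).
  by rewrite trmx_mul Qs !mulmxA mulmxKV.
apply: V0; apply: contra_neq x0 => h.
by rewrite -(mulKVmx Vu x) h mulmx0.
Qed.

Lemma mx_posdef_scalar m (s : R) : 0 < s -> mx_posdef (s%:M : 'M[R]_m).
Proof.
move=> s0; split => [|x x0]; first by rewrite /mx_symmetric tr_scalar_mx.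
rewrite mul_mx_scalar -scalemxAl mxE -mx_norm2_dot mulr_gt0// exprn_gt0//.
by rewrite lt_def mx_norm2_eq0 x0 mx_norm2_ge0.
Qed.

Lemma invmx_uniq m (A B : 'M[R]_m) : A *m B = 1%:M -> invmx A = B.
Proof.
move=> AB; have [Au _] := mulmx1_unit AB.
by rewrite -[B](mulKmx Au) AB mulmx1.
Qed.

Lemma det_1D_mulC m n (A : 'M[R]_(n, m)) (B : 'M[R]_(m, n)) :
  \det (1%:M + A *m B) = \det (1%:M + B *m A).
Proof.
have h1 : block_mx 1%:M 0 B 1%:M *m block_mx 1%:M (- A) 0 (1%:M + B *m A) =
          block_mx 1%:M (- A) B 1%:M.
  rewrite mulmx_block !(mul1mx, mulmx1, mul0mx, mulmx0, addr0, add0r) mulmxN.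
  by rewrite addrCA addNr addr0.
have h2 : block_mx (1%:M + A *m B) (- A) 0 1%:M *m block_mx 1%:M 0 B 1%:M =
          block_mx 1%:M (- A) B 1%:M.
  rewrite mulmx_block !(mul1mx, mulmx1, mul0mx, mulmx0, addr0, add0r) mulNmx.
  by rewrite addrK.
have := congr1 determinant h1; rewrite -h2 !det_mulmx !det_ublock !det_lblock.
by rewrite !det1 !mul1r !mulr1 => ->.
Qed.

Lemma det_1D_gram m n (V : 'M[R]_m) (D : 'M[R]_(n, m)) : mx_posdef V ->
  \det (1%:M + D *m invmx V *m D^T) = \det (V + D^T *m D) / \det V.
Proof.
move=> /mx_posdef_unit Vu; rewrite -mulmxA det_1D_mulC -mulmxA.
rewrite -[in LHS](mulVmx Vu) -mulmxDr det_mulmx det_inv mulrC //.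
Qed.

Lemma hadamard_posdef m (V : 'M[R]_m) : mx_posdef V ->
  0 < \det V <= \prod_(i < m) V i i.
Proof.
elim: m V => [|m IH] V; first by move=> _; rewrite det_mx00 big_ord0 ltr01 lexx.
move=> Vp; have [Vs V0] := Vp.
rewrite -[m.+1]/(1 + m)%N in V Vp Vs V0 *.
pose C := drsubmx V; pose b := ursubmx V; pose a := ulsubmx V.
have VE : V = block_mx a b b^T C.
  by rewrite -[LHS]submxK; congr block_mx; rewrite -{1}Vs -trmx_ursub.
have Cp : mx_posdef C.
  split; first by rewrite /mx_symmetric /C trmx_drsub Vs.
  move=> x x0; have := V0 (col_mx 0 x).
  have -> : (col_mx 0 x)^T *m V *m col_mx 0 x = x^T *m C *m x.
    rewrite VE tr_col_mx mul_row_block mul_row_col trmx0 !mul0mx !add0r.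
    by rewrite mulmx0 add0r.
  apply; apply: contra_neq x0 => h.
  by rewrite -[x](@col_mxKd _ 1 m 1 0) h linear0.
have Cu := mx_posdef_unit Cp.
have [Cs _] := Cp; have /andP[dC0 dC] := IH _ Cp.
have Qp := mx_posdef_inv Cp; have [Qs Q0] := Qp.
pose s := a - b *m invmx C *m b^T.
have detV : \det V = s 0 0 * \det C.
  have -> : V = block_mx 1%:M (b *m invmx C) 0 1%:M *m block_mx s 0 b^T C.
    rewrite mulmx_block !(mul1mx, mul0mx, mulmx0, addr0, add0r) mulmxKV//.
    by rewrite VE /s subrK.
  by rewrite det_mulmx det_ublock det_lblock !det1 !mul1r -det_mx11.
have s0 : 0 < s 0 0.
  pose y : 'cV[R]_(1 + m) := col_mx 1%:M (- (invmx C *m b^T)).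
  have <- : (y^T *m V *m y) = s.
    rewrite VE tr_col_mx mul_row_block mul_row_col trmx1 !mul1mx mulmx1.
    rewrite raddfN /= trmx_mul trmxK Qs !mulNmx mulmxKV// subrr mul0mx addr0.
    by [].
  apply: V0; apply: contra_eq_neq (col_mxKu 1%:M (- (invmx C *m b^T))) => h.
  rewrite -/y h linear0; apply/eqP => /matrixP /(_ 0 0); rewrite !mxE /=.
  by move=> /esym /eqP; rewrite oner_eq0.
rewrite detV mulr_gt0//= big_ord_recl.
have -> : \prod_(i < m) V (lift ord0 i) (lift ord0 i) = \prod_(i < m) C i i.
  apply: eq_bigr => i _; rewrite !mxE; congr (V _ _); exact/val_inj.
apply: ler_pM => //; [exact: ltW|exact: ltW|].
have -> : s 0 0 = a 0 0 - (b *m invmx C *m b^T) 0 0.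
  by rewrite [LHS]mxE; congr (_ + _); rewrite mxE.
apply: (@le_trans _ _ (a 0 0)); last first.
  rewrite /a !mxE le_eqVlt; apply/orP; left; apply/eqP; congr (V _ _); exact/val_inj.
rewrite lerBlDr lerDl; have [->|b0] := eqVneq b 0; first by rewrite !mul0mx mxE.
by rewrite -[b]trmxK; apply/ltW; rewrite trmxK -{1}[b]trmxK Q0// trmx_eq0.
Qed.

Lemma ler_det_1D_gram m n (s : R) (D : 'M[R]_(n, m)) : 0 < s -> mx_opnorm D <= s ->
  \det (1%:M + D *m invmx ((s ^+ 2)%:M) *m D^T) <= 2 ^+ m.
Proof.
move=> s0 Ds; have s2 : 0 < s ^+ 2 by rewrite exprn_gt0.
have s2n : s ^+ 2 != 0 by rewrite gt_eqF.
rewrite -mulmxA det_1D_mulC invmx_scalar mul_scalar_mx -scalemxAl.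
have -> : 1%:M + (s ^- 2) *: (D^T *m D) =
   1%:M + (s^-1 *: D)^T *m (s^-1 *: D).
  have -> : (s^-1 *: D)^T = s^-1 *: D^T by rewrite linearZ.
  by rewrite -scalemxAl -scalemxAr scalerA -expr2 exprVn.
have /andP[_ h] := hadamard_posdef (mx_posdefD_gram (s^-1 *: D) (mx_posdef_scalar m ltr01)).
apply: (le_trans h); rewrite -[leRHS]mul1r -[m in leRHS]card_ord -prodr_const mul1r.
apply: ler_prod => i _.
have -> : (1%:M + (s^-1 *: D)^T *m (s^-1 *: D)) i i =
   1 + mx_norm2 (s^-1 *: (D *m delta_mx i (0 : 'I_1))) ^+ 2.
  rewrite mxE mxE eqxx mulr1n; congr (_ + _).
  rewrite mx_norm2_sqr mxE; apply: eq_bigr => j _; rewrite -colE !mxE expr2 //.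
rewrite addr_ge0 ?sqr_ge0//= -[2]/(1 + 1) lerD2l expr_le1 ?mx_norm2_ge0//.
rewrite mx_norm2Z gtr0_norm ?invr_gt0// mulrC ler_pdivrMr// mul1r.
apply: (le_trans (mx_opnorm_ub _ _)).
suff -> : mx_norm2 (delta_mx i 0 : 'cV[R]_m) = 1 by rewrite mulr1.
rewrite /mx_norm2 (bigD1 i)//= mxE !eqxx expr1n big1 ?addr0 ?sqrtr1// => j ji.
by rewrite mxE (negbTE ji) expr0n.
Qed.

End PositiveDefinite.

Section RankOneUpdate.
Variables (R : realType) (m : nat) (V : 'M[R]_m) (e : 'cV[R]_m).
Hypothesis Vp : mx_posdef V.
Let Q : 'M[R]_m := invmx V.
Let a : R := (e^T *m Q *m e) 0 0.

Lemma quad_inv_ge0 : 0 <= a.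
Proof.
rewrite /a; have [->|e0] := eqVneq e 0; first by rewrite mulmx0 mxE.
by apply/ltW; exact: (mx_posdef_inv Vp).2.
Qed.

Lemma quad_inv_eq0 : a = 0 -> e = 0.
Proof.
move=> a0; apply/eqP; apply: contra_eqT a0 => e0.
by rewrite gt_eqF// (mx_posdef_inv Vp).2.
Qed.

Lemma mx_posdefD_rank1 : mx_posdef (V + e *m e^T).
Proof. by rewrite -[X in X *m _]trmxK; exact: mx_posdefD_gram. Qed.

Lemma det_rank1 : \det (V + e *m e^T) = \det V * (1 + a).
Proof.
have Vu := mx_posdef_unit Vp.
have -> : V + e *m e^T = V *m (1%:M + (Q *m e) *m e^T).
  by rewrite mulmxDr mulmx1 !mulmxA mulmxV// mul1mx.
by rewrite det_mulmx det_1D_mulC [X in _ * X]det_mx11 mulmxA mxE mxE eqxx.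
Qed.

(* Sherman-Morrison *)
Lemma invmx_rank1 :
  invmx (V + e *m e^T) = Q - (1 + a)^-1 *: ((Q *m e) *m (Q *m e)^T).
Proof.
have Vu := mx_posdef_unit Vp; have Qs := (mx_posdef_inv Vp).1.
have a1 : 1 + a != 0 by rewrite gt_eqF// ltr_pwDl// quad_inv_ge0.
apply: invmx_uniq; rewrite trmx_mul Qs mulmxDl !mulmxBr -!scalemxAr !mulmxA.
rewrite mulmxV// mul1mx.
have -> : e *m e^T *m Q *m e = a *: e.
  by rewrite -!mulmxA (mulmxA e^T) [X in _ *m X]mx11_scalar mul_mx_scalar.
rewrite -!scalemxAl scalerA -/Q addrAC -[RHS]addr0 -!addrA; congr (_ + _).
apply/matrixP => i j; rewrite !mxE; set y := \sum_(_ < _) _.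
by field.
Qed.

Lemma quad_rank1 (z : 'cV[R]_m) (x : R) :
  let b := (e^T *m Q *m z) 0 0 in
  ((z + x *: e)^T *m invmx (V + e *m e^T) *m (z + x *: e)) 0 0 =
  (z^T *m Q *m z) 0 0 + (2 * b * x + a * x ^+ 2 - b ^+ 2) / (1 + a).
Proof.
move=> b; have Qs : Q^T = Q := (mx_posdef_inv Vp).1.
have a1 : 1 + a != 0 by rewrite gt_eqF// ltr_pwDl// quad_inv_ge0.
have bS : (z^T *m Q *m e) 0 0 = b.
  have -> : z^T *m Q *m e = (e^T *m Q *m z)^T by rewrite !trmx_mul trmxK Qs mulmxA.
  by rewrite mxE.
have qE (y : 'cV[R]_m) : (y^T *m invmx (V + e *m e^T) *m y) 0 0 =
    (y^T *m Q *m y) 0 0 - (1 + a)^-1 * (y^T *m Q *m e) 0 0 ^+ 2.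
  rewrite invmx_rank1 mulmxBr mulmxBl -scalemxAr -scalemxAl.
  have -> : y^T *m (Q *m e *m (Q *m e)^T) *m y =
     (y^T *m Q *m e) *m (y^T *m Q *m e)^T.
    by rewrite !trmx_mul trmxK Qs !mulmxA.
  rewrite 4!mxE; congr (_ - _ * _).
  by rewrite mxE big_ord1 [X in _ * X]mxE expr2.
have eL : (z + x *: e)^T = z^T + x *: e^T by rewrite raddfD /= linearZ.
have coef (M N : 'M[R]_1) : (M + N) 0 0 = M 0 0 + N 0 0 by rewrite mxE.
have coefZ (c : R) (M : 'M[R]_1) : (c *: M) 0 0 = c * M 0 0 by rewrite mxE.
rewrite qE eL !mulmxDl !mulmxDr -!scalemxAl -!scalemxAr !coef !coefZ bS -/a -/b.
by field.
Qed.

End RankOneUpdate.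

Section Net.
Variable R : realType.

Lemma geometric_half_le (K : nat) : \sum_(i < K) (2^-1 : R) ^+ i <= 2.
Proof.
suff -> : \sum_(i < K) (2^-1 : R) ^+ i = 2 - 2 * 2^-1 ^+ K.
  by rewrite gerBl mulr_ge0// exprn_ge0// invr_ge0.
elim: K => [|K IH]; first by rewrite big_ord0 expr0 mulr1 subrr.
by rewrite big_ord_recr /= IH exprS; field.
Qed.

Let signed_grid (p K : nat) := {ffun 'I_p -> 'I_K * bool}.

Let grid_point (p K : nat) (f : signed_grid p K) : 'cV[R]_p :=
  \col_i ((-1) ^+ (f i).2 * ((f i).1 : nat)%:R / (2 * Num.sqrt p%:R)).

Let grid_ball (p K : nat) : {set signed_grid p K} :=
  [set f : signed_grid p K | (\sum_i (f i).1 ^ 2 <= 4 * p)%N].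

(* Each point is charged the weight [prod_i 2^-n_i]: the total weight of the
   grid is at most [4^p], and each point of the ball weighs at least [2^-4p]. *)
Let card_grid_ball (p K : nat) : (#|grid_ball p K|)%:R <= 2 ^+ (6 * p) :> R.
Proof.
have h (f : signed_grid p K) : f \in grid_ball p K ->
    1 <= 2 ^+ (4 * p) * \prod_i (2^-1 : R) ^+ (f i).1.
  rewrite inE => fK; rewrite -expr_sum exprVn.
  rewrite ler_pdivlMr ?exprn_gt0// mul1r ler_weXn2l// ?ler1n//.
  apply: leq_trans fK; apply: leq_sum => i _.
  by case: (nat_of_ord _) => // n; rewrite expnS expn1 leq_pmulr.
rewrite -sum1_card natr_sum.
apply: (@le_trans _ _ (\sum_(f : signed_grid p K)
    2 ^+ (4 * p) * \prod_i (2^-1 : R) ^+ (f i).1)).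
  rewrite [leRHS](bigID (mem (grid_ball p K)))/= -[leLHS]addr0 lerD//.
    by apply: ler_sum => f; exact: h.
  apply: sumr_ge0 => f _; rewrite mulr_ge0 ?exprn_ge0//.
  by apply: prodr_ge0 => i _; rewrite exprn_ge0 ?invr_ge0.
rewrite -mulr_sumr -(bigA_distr_bigA (fun _ (x : 'I_K * bool) => (2^-1 : R) ^+ x.1)).
rewrite (_ : 6 * p = 4 * p + 2 * p)%N; last by rewrite -mulnDl.
rewrite exprD ler_wpM2l ?exprn_ge0// exprM -[p in leRHS]card_ord -prodr_const.
apply: ler_prod => _ _; apply/andP; split.
  by apply: sumr_ge0 => i _; rewrite exprn_ge0 ?invr_ge0.
rewrite -(pair_bigA _ (fun (i : 'I_K) (b : bool) => (2^-1 : R) ^+ i)) /=.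
under eq_bigr => i _ do rewrite big_bool/= -mulr2n.
rewrite sumrMnl [leRHS](_ : _ = 2 *+ 2); last by ring.
by rewrite ler_wMn2r// geometric_half_le.
Qed.

Let grid_point_norm (p K : nat) (f : signed_grid p K) : (0 < p)%N ->
  f \in grid_ball p K -> mx_norm2 (grid_point f) <= 1.
Proof.
move=> p0; rewrite inE => fK.
rewrite -(@expr_le1 _ 2)// ?mx_norm2_ge0// mx_norm2_sqr.
under eq_bigr => i _ do rewrite mxE exprMn exprMn sqrr_sign mul1r exprVn.
rewrite -mulr_suml exprMn sqr_sqrtr// ler_pdivrMr ?mulr_gt0 ?ltr0n// mul1r.
under eq_bigr => i _ do rewrite -natrX.
by rewrite -natr_sum -natrX -natrM ler_nat.
Qed.

(* Rounding the coordinates of [2 sqrt p w] towards zero. *)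
Let grid_approx (p : nat) (w : 'cV[R]_p) : (0 < p)%N -> mx_norm2 w <= 1 ->
  exists2 f : signed_grid p (4 * p).+1, f \in grid_ball p (4 * p).+1 &
    mx_norm2 (w - grid_point f) <= 2^-1.
Proof.
move=> p0 w1; set s : R := 2 * Num.sqrt p%:R.
have s0 : 0 < s by rewrite mulr_gt0// sqrtr_gt0 ltr0n.
have s2 : s ^+ 2 = 4 * p%:R by rewrite exprMn sqr_sqrtr// -natrX.
pose n (i : 'I_p) := Num.truncn (s * `|w i 0|).
have nP i : (n i)%:R <= s * `|w i 0| < (n i).+1%:R.
  by apply: truncn_itv; rewrite mulr_ge0// ltW.
have nS : (\sum_i n i ^ 2 <= 4 * p)%N.
  rewrite -(ler_nat R) natr_sum natrM -s2.
  apply: (@le_trans _ _ (\sum_i s ^+ 2 * w i 0 ^+ 2)).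
    apply: ler_sum => i _; rewrite -[w i 0 ^+ 2]real_normK ?num_real// -exprMn natrX.
    rewrite lerXn2r ?nnegrE//; last by case/andP: (nP i).
    by rewrite mulr_ge0// ltW.
  rewrite -mulr_sumr -mx_norm2_sqr ler_piMr ?sqr_ge0//.
  by rewrite expr_le1// mx_norm2_ge0.
have nK i : (n i < (4 * p).+1)%N.
  rewrite ltnS; apply: leq_trans nS; rewrite (bigD1 i)//=.
  apply: leq_trans (leq_addr _ _).
  by case: (n i) => // k; rewrite expnS expn1 leq_pmulr.
exists [ffun i => (inord (n i), w i 0 < 0)].
  rewrite inE (eq_bigr (fun i => n i ^ 2)%N)// => i _.
  by rewrite ffunE /= inordK.
rewrite -(@ler_pXn2r _ 2)// ?nnegrE ?mx_norm2_ge0 ?invr_ge0// mx_norm2_sqr.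
apply: (@le_trans _ _ (\sum_(i < p) (s ^- 2))).
  apply: ler_sum => i _; rewrite !mxE ffunE /= inordK//.
  rewrite -exprVn -/s -[leLHS]real_normK ?num_real//.
  rewrite lerXn2r ?nnegrE ?normr_ge0 ?invr_ge0 ?(ltW s0)//.
  rewrite {1}[w i 0]realEsign ?num_real//.
  rewrite -mulrA -mulrBr normrM normr_sign mul1r.
  have /andP[h1 h2] := nP i.
  rewrite ger0_norm; last by rewrite subr_ge0 ler_pdivrMr// mulrC.
  by rewrite lerBlDr -[X in X + _]mul1r -mulrDl ler_pdivlMr// mulrC addrC natr1 ltW.
rewrite sumr_const card_ord -mulr_natl s2.
have pn : p%:R != 0 :> R by rewrite pnatr_eq0 -lt0n.
by rewrite le_eqVlt; apply/orP; left; apply/eqP; field.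
Qed.

Lemma operator_norm_net (p : nat) : (0 < p)%N ->
  exists s : seq 'cV[R]_p,
  [/\ (0 < size s)%N, {in s, forall z, mx_norm2 z <= 1},
      ln (size s)%:R <= (if p == 1 then 0 else 6 * p%:R : R) &
      forall (q : nat) (A : 'M[R]_(q, p)) (B : R),
        {in s, forall z, mx_norm2 (A *m z) <= B} -> mx_opnorm A <= 2 * B].
Proof.
move=> p0; have [->|p1] := eqVneq p 1%N.
  have one1 : mx_norm2 (1%:M : 'cV[R]_1) = 1.
    by rewrite /mx_norm2 big_ord1 mxE eqxx expr1n sqrtr1.
  exists [:: 1%:M]; split => //=.
  - by move=> z; rewrite inE => /eqP ->; rewrite one1.
  - by rewrite ln1.
  move=> q A B /(_ 1%:M); rewrite inE eqxx => /(_ isT) hB.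
  have B0 : 0 <= B by apply: le_trans hB; exact: mx_norm2_ge0.
  rewrite mulmx1 in hB.
  apply: mx_opnorm_leP => [|x]; first by rewrite mulr_ge0.
  rewrite [x]mx11_scalar -scalemx1 -scalemxAr mulmx1 !mx_norm2Z one1 mulr1 mulrC.
  by rewrite ler_wpM2r//; lra.
pose K := (4 * p).+1.
exists [seq grid_point f | f in grid_ball p K].
have mem f : f \in grid_ball p K ->
    grid_point f \in [seq grid_point f | f in grid_ball p K].
  by move=> fK; exact: fintype.image_f.
have g0 : (0 < size [seq grid_point f | f in grid_ball p K])%N.
  rewrite size_image; apply/card_gt0P.
  have [|f fK _] := @grid_approx p 0 p0; first by rewrite mx_norm2_0.
  by exists f.
split => //.
- by move=> _ /fintype.imageP[f fK ->]; exact: grid_point_norm.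
- rewrite size_image; rewrite size_image in g0.
  apply: (@le_trans _ _ (ln (2 ^+ (6 * p)))).
    by rewrite ler_ln ?posrE ?ltr0n ?exprn_gt0// card_grid_ball.
  have ln2 : ln 2 <= 1 :> R by have := @le_ln1Dx R 1; apply; lra.
  by rewrite lnXn// -[leLHS]mulr_natr natrM ler_piMl.
move=> q A B hB; set a := mx_opnorm A.
suff : a <= B + 2^-1 * a by lra.
apply: mx_opnorm_le => w w1; have [f fK fw] := grid_approx p0 w1.
have -> : w = grid_point f + (w - grid_point f) by rewrite addrC subrK.
rewrite mulmxDr; apply: (le_trans (ler_mx_norm2D _ _)); apply: lerD.
  by apply: hB; exact: mem.
apply: (le_trans (mx_opnorm_ub _ _)); rewrite mulrC ler_wpM2r//.
exact: mx_opnorm_ge0.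
Qed.

Lemma ptilde_ge0 (p T : nat) : 0 <= ptilde p T :> R.
Proof.
by rewrite /ptilde mulr_ge0// le_min ler0n mulr_ge0// sqr_ge0.
Qed.

Lemma half_le_ln2 : 2^-1 <= ln 2 :> R.
Proof.
have := @le_ln1Dx R (- 2^-1); rewrite (_ : 1 + - 2^-1 = 2^-1 :> R); last by field.
rewrite lnV ?posrE//; have : -1 < - 2^-1 :> R by lra.
by move=> h /(_ h); lra.
Qed.

Lemma ptilde_ge (p T : nat) : (1 < p)%N -> (0 < T)%N -> p%:R / 2 <= ptilde p T :> R.
Proof.
move=> p1 T0; rewrite /ptilde ler_wpM2l// le_min; apply/andP; split.
  have : 1 <= T%:R :> R by rewrite ler1n.
  by lra.
set x : R := (T * p)%:R.
have x2 : 2 <= x by rewrite ler_nat (leq_trans p1)// leq_pmull.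
have x0 : 0 < x by lra.
have lx : 2^-1 <= ln x.
  by apply: (le_trans half_le_ln2); rewrite ler_ln ?posrE.
rewrite lnM ?posrE ?expR_gt0// expRK -exprMn.
nra.
Qed.

End Net.

Section ConditionalSubgaussian.
Context {R : realType} {d : measure_display} {Omega : measurableType d}.
Variable P : probability Omega R.

Lemma measurable_wrtP (G : set (set Omega)) (f : Omega -> R) :
  sigma_algebra setT G ->
  measurable_wrt G f <-> measurable_fun setT (f : g_sigma_algebraType G -> R).
Proof.
move=> sG; split => [h _ B mB|h B mB].
  by rewrite setTI; apply: sub_sigma_algebra; exact: h.
by have := h measurableT B mB; rewrite setTI /measurable/= sigma_algebra_id.
Qed.

Lemma measurable_wrt_measurable (G : set (set Omega)) (f : Omega -> R) :
  G `<=` measurable -> measurable_wrt G f -> measurable_fun setT f.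
Proof. by move=> GM h _ B mB; rewrite setTI; apply: GM; exact: h. Qed.

Lemma measurable_wrt_le (G H : set (set Omega)) (f : Omega -> R) :
  G `<=` H -> measurable_wrt G f -> measurable_wrt H f.
Proof. by move=> GH h B mB; apply: GH; exact: h. Qed.

Import HBNNSimple.

Section SubSigmaAlgebra.
Variable G : set (set Omega).
Hypothesis sG : sigma_algebra setT G.
Hypothesis GM : G `<=` measurable.

Lemma ge0_integral_cond_le (h g : Omega -> R) (c : R) :
  (forall x, 0 <= h x) -> measurable_fun setT h -> 0 <= c ->
  (forall A, G A -> (\int[P]_(x in A) (h x)%:E <= P A * c%:E)%E) ->
  (forall x, 0 <= g x) -> measurable_wrt G g ->
  (\int[P]_x (g x * h x)%:E <= \int[P]_x (g x)%:E * c%:E)%E.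
Proof.
move=> h0 mh c0 hG g0 mg.
have mg' : measurable_fun setT (EFin \o g : g_sigma_algebraType G -> \bar R).
  by apply/measurable_EFinP; apply/measurable_wrtP.
pose phi : {nnsfun (g_sigma_algebraType G) >-> R}^nat := nnsfun_approx measurableT mg'.
have Gphi n B : measurable B -> G (phi n @^-1` B).
  move=> mB; have := @measurable_funPT _ _ _ _ (phi n) measurableT B mB.
  by rewrite setTI /measurable/= sigma_algebra_id.
have mphi n : measurable_fun [set: Omega] (phi n : Omega -> R).
  by move=> _ B mB; rewrite setTI; apply: GM; exact: Gphi.
have phi0 n x : 0 <= phi n x by exact: fun_ge0.
have mgO : measurable_fun [set: Omega] g by exact: measurable_wrt_measurable mg.
have phi_cvg x : EFin \o phi ^~ x @ \oo --> (g x)%:E.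
  by apply: cvg_nnsfun_approx => // y _; rewrite lee_fin.
have phi_nd x : nondecreasing_seq (phi ^~ x).
  by move=> a b ab; apply/lefP; exact: nd_nnsfun_approx.
have phi_le n x : phi n x <= g x.
  rewrite -lee_fin; have := phi_cvg x => /cvg_lim <- //.
  apply: lime_ge; first exact: (cvgP _ (phi_cvg x)).
  near=> k; rewrite lee_fin; apply: phi_nd; near: k; exact: nbhs_infty_ge.
have simple n : (\int[P]_x (phi n x * h x)%:E <= \int[P]_x (phi n x)%:E * c%:E)%E.
  pose s : seq R := fset_set (range (phi n)).
  pose A y : set Omega := phi n @^-1` [set y].
  have phiE (x : Omega) : phi n x = \sum_(y <- s) y * \1_(A y) x.
    by rewrite {1}(fimfunE (phi n) x) fsbig_finite.
  have mset y : measurable (A y).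
    by apply: GM; apply: Gphi.
  have phi_int (k : Omega -> R) : (forall x, 0 <= k x) -> measurable_fun setT k ->
      (\int[P]_x (phi n x * k x)%:E =
       \sum_(y <- s) `|y|%:E * \int[P]_(x in A y) (k x)%:E)%E.
    move=> k0 mk.
    transitivity (\int[P]_x \sum_(y <- s)
        (`|y|%:E * (\1_(A y) x * k x)%:E))%E.
      apply: eq_integral => x _; rewrite phiE mulr_suml -sumEFin.
      apply: eq_big_seq => y ys; rewrite -EFinM mulrA ger0_norm//.
      have : y \in fset_set (range (phi n)) := ys.
      by rewrite in_fset_set// => /set_mem [z _ <-].
    have mk1 y : measurable_fun setT (fun x : Omega => (\1_(A y) x * k x)%:E).
      by apply/measurable_EFinP; apply: measurable_funM => //; exact: measurable_indic.
    have k10 y (x : Omega) : (0 <= (\1_(A y) x * k x)%:E)%E.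
      by rewrite lee_fin mulr_ge0.
    rewrite ge0_integral_sum//; last 2 first.
    - by move=> y; apply: measurable_funeM.
    - by move=> y x _; rewrite mule_ge0// lee_fin.
    apply: eq_bigr => y _; rewrite ge0_integralZl_EFin//; congr (_ * _)%E.
    rewrite [RHS]integral_mkcond; apply: eq_integral => x _.
    by rewrite epatch_indic /= -EFinM mulrC.
  have := phi_int (cst 1) (fun=> ler01) (measurable_cst _).
  under eq_integral do rewrite /= mulr1.
  move=> ->; rewrite phi_int// ge0_sume_distrl; last first.
    by move=> y _; rewrite mule_ge0// ?lee_fin// integral_ge0// => x _; rewrite lee_fin.
  apply: lee_sum => y _; rewrite -muleA lee_wpmul2l// ?lee_fin//.
  apply: (le_trans (hG _ (Gphi n _ (measurable_set1 y)))).
  by rewrite (integral_cst P (mset y) 1%E) mul1e.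
have -> : (\int[P]_x (g x * h x)%:E =
    \int[P]_x limn (fun n => (phi n x * h x)%:E))%E.
  apply: eq_integral => x _; apply/esym/cvg_lim => //.
  under eq_fun do rewrite EFinM.
  rewrite EFinM; apply: cvgeM; [exact: mule_def_fin|exact: phi_cvg|exact: cvg_cst].
have mc1 n : measurable_fun setT (fun x : Omega => (phi n x * h x)%:E).
  by apply/measurable_EFinP; exact: measurable_funM.
have mc2 n (x : Omega) : setT x -> (0 <= (phi n x * h x)%:E)%E.
  by rewrite lee_fin mulr_ge0.
have mc3 (x : Omega) : setT x -> nondecreasing_seq (fun n => (phi n x * h x)%:E).
  by move=> _ a b ab; rewrite lee_fin ler_wpM2r//; exact: phi_nd.
have mc := @cvg_monotone_convergence _ _ _ P setT measurableT
  (fun n x => (phi n x * h x)%:E) mc1 mc2 mc3.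
rewrite -(cvg_lim _ mc)//; apply: lime_le; first exact: cvgP mc.
apply: nearW => n; apply: (le_trans (simple n)).
rewrite lee_wpmul2r ?lee_fin//; apply: ge0_le_integral => //.
- by move=> x _; rewrite lee_fin.
- exact/measurable_EFinP.
- exact/measurable_EFinP.
- by move=> x _; rewrite lee_fin.
Unshelve. all: by end_near. Qed.

End SubSigmaAlgebra.

Lemma measurable_normal_pdf_comp d' (T : measurableType d') (A B L : T -> R) :
  (forall t, 0 < A t) ->
  measurable_fun setT A -> measurable_fun setT B -> measurable_fun setT L ->
  measurable_fun setT (fun t => normal_pdf (B t) (Num.sqrt (A t)) (L t)).
Proof.
move=> A0 mA mB mL.
rewrite (_ : (fun t => _) = fun t =>
   expR (- (ln (A t * pi *+ 2) / 2)) *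
   expR (- (L t - B t) ^+ 2 * (expR (- ln (A t)) / 2))); last first.
  apply/funext => t; rewrite normal_pdfE ?gt_eqF ?sqrtr_gt0//.
  rewrite /normal_peak /normal_fun sqr_sqrtr ?ltW//; congr (_ * expR _).
    have Ap : 0 < A t * pi *+ 2 by rewrite pmulrn_lgt0// mulr_gt0 ?pi_gt0.
    rewrite expRN; congr (_^-1).
    rewrite -{1}[A t * pi *+ 2]lnK ?posrE// -[in LHS](@divfK _ 2 _ (ln _))//.
    by rewrite expRM_natr sqrtr_sqr ger0_norm// expR_ge0.
  rewrite expRN lnK ?posrE//; congr (_ * _).
  by rewrite -mulr_natr invfM.
apply: measurable_funM; apply: measurableT_comp => //.
  apply: measurable_funN; apply: measurable_funM => //.
  apply: measurableT_comp => //; rewrite /=.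
  under eq_fun do rewrite -mulr_natr -mulrA.
  exact: measurable_funM.
apply: measurable_funM.
  by apply: measurable_funN; apply: measurable_funX; exact: measurable_funB.
apply: measurable_funM => //; apply: measurableT_comp => //.
by apply: measurable_funN; exact: measurableT_comp.
Qed.

Lemma normal_pdf_shift (a b x l : R) : 0 < a ->
  expR (l * x - l ^+ 2 / 2) * normal_pdf b (Num.sqrt a) l =
  expR ((2 * b * x + a * x ^+ 2 - b ^+ 2) / (2 * (1 + a)) - ln (1 + a) / 2) *
  normal_pdf ((a * x + b) / (1 + a)) (Num.sqrt (a / (1 + a))) l.
Proof.
move=> a0; have a1 : 0 < 1 + a by rewrite addr_gt0.
have aa : 0 < a / (1 + a) by rewrite divr_gt0.
rewrite !normal_pdfE ?gt_eqF ?sqrtr_gt0//.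
rewrite /normal_peak /normal_fun !sqr_sqrtr ?ltW//.
have -> : (Num.sqrt (a / (1 + a) * pi *+ 2))^-1 =
   expR (ln (1 + a) / 2) * (Num.sqrt (a * pi *+ 2))^-1.
  have gen (q : R) : a / (1 + a) * q *+ 2 = (1 + a)^-1 * (a * q *+ 2).
    by ring.
  rewrite gen.
  rewrite sqrtrM ?invr_ge0 ?ltW// invfM; congr (_ * _).
  rewrite -{1}[1 + a]lnK ?posrE// -expRN -[- ln _](@divfK _ 2 _)//.
  by rewrite expRM_natr sqrtr_sqr ger0_norm ?expR_ge0// -expRN mulNr opprK.
move: (Num.sqrt (a * pi *+ 2))^-1 => c.
rewrite mulrCA [RHS]mulrA (mulrA (expR _)) -expRD [RHS]mulrAC -!expRD mulrC.
congr (expR _ * _); move: (ln (1 + a)) => q.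
by field; rewrite !gt_eqF.
Qed.


Definition cond_subgaussian (G : set (set Omega)) (x : Omega -> R) : Prop :=
  forall (l : R) (A : set Omega), G A ->
    (\int[P]_(w in A) (expR (l * x w))%:E <= P A * (expR (l ^+ 2 / 2))%:E)%E.

Section OneStep.
Variable G : set (set Omega).
Hypothesis sG : sigma_algebra setT G.
Hypothesis GM : G `<=` measurable.
Variables x : Omega -> R.
Hypothesis mx : measurable_fun setT x.
Hypothesis xsub : cond_subgaussian G x.

Let K (a b y : R) : R :=
  expR ((2 * b * y + a * y ^+ 2 - b ^+ 2) / (2 * (1 + a)) - ln (1 + a) / 2).

(* By [normal_pdf_shift], [K a b y] is the average of [exp (l y - l^2 / 2)] for
   [l] normal of mean [b] and variance [a]; Tonelli's theorem then reduces to
   one [l] at a time. *)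
Let step_gt0 (W a b : Omega -> R) :
  measurable_wrt G W -> measurable_wrt G a -> measurable_wrt G b ->
  (forall w, 0 <= W w) -> (forall w, 0 < a w) ->
  (\int[P]_w (W w * K (a w) (b w) (x w))%:E <= \int[P]_w (W w)%:E)%E.
Proof.
move=> mW ma mb W0 a0.
pose phi w l := normal_pdf (b w) (Num.sqrt (a w)) l.
have phi0 w l : 0 <= phi w l by exact: normal_pdf_ge0.
have toO (f : Omega -> R) : measurable_wrt G f -> measurable_fun [set: Omega] f.
  exact: measurable_wrt_measurable.
have mfst (f : Omega -> R) : measurable_fun setT f ->
    measurable_fun setT (fun z : Omega * R => f z.1).
  by move=> mf; apply: measurableT_comp => //; exact: measurable_fst.
have msnd : measurable_fun setT (fun z : Omega * R => z.2) by exact: measurable_snd.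
have mphi2 : measurable_fun setT (fun z : Omega * R => phi z.1 z.2).
  by apply: measurable_normal_pdf_comp => //; apply: mfst; exact: toO.
have mphiG l : measurable_wrt G (fun w => phi w l).
  apply/measurable_wrtP => //; apply: measurable_normal_pdf_comp => //.
  - by apply/measurable_wrtP.
  - by apply/measurable_wrtP.
have mWphiG l : measurable_wrt G (fun w => W w * phi w l).
  by apply/measurable_wrtP => //; apply: measurable_funM; apply/measurable_wrtP.
pose F2 (z : Omega * R) := (W z.1 * phi z.1 z.2)%:E.
pose F1 (z : Omega * R) :=
  (W z.1 * phi z.1 z.2 * expR (z.2 * x z.1 - z.2 ^+ 2 / 2))%:E.
have mF2 : measurable_fun setT F2.
  by apply/measurable_EFinP; apply: measurable_funM => //; apply: mfst; exact: toO.
have mF1 : measurable_fun setT F1.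
  apply/measurable_EFinP; apply: measurable_funM.
    by apply: measurable_funM => //; apply: mfst; exact: toO.
  apply: measurableT_comp => //; apply: measurable_funB.
    by apply: measurable_funM => //; exact: mfst.
  by apply: measurable_funM => //; exact: measurable_funX.
have F10 z : (0 <= F1 z)%E by rewrite lee_fin !mulr_ge0// expR_ge0.
have F20 z : (0 <= F2 z)%E by rewrite lee_fin mulr_ge0.
have intpdf (c m s : R) : 0 <= c ->
    (\int[lebesgue_measure]_l (c * normal_pdf m s l)%:E = c%:E)%E.
  move=> c0; under eq_integral do rewrite EFinM.
  rewrite ge0_integralZl_EFin//.
  - by rewrite integral_normal_pdf mule1.
  - by move=> l _; rewrite lee_fin normal_pdf_ge0.
  - by apply/measurable_EFinP; exact: measurable_normal_pdf.
have -> : (\int[P]_w (W w * K (a w) (b w) (x w))%:E =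
           \int[P]_w \int[lebesgue_measure]_l F1 (w, l))%E.
  apply: eq_integral => w _; rewrite -[LHS](intpdf _ ((a w * x w + b w) / (1 + a w))
    (Num.sqrt (a w / (1 + a w)))); last by rewrite mulr_ge0// expR_ge0.
  apply: eq_integral => l _; rewrite /F1 /= /K; congr EFin.
  rewrite -mulrA -[RHS]mulrA; congr (_ * _).
  by rewrite -(normal_pdf_shift (b w) (x w) l (a0 w)) mulrC.
have -> : (\int[P]_w (W w)%:E =
           \int[P]_w \int[lebesgue_measure]_l F2 (w, l))%E.
  by apply: eq_integral => w _; rewrite -[LHS](intpdf _ (b w) (Num.sqrt (a w))).
rewrite (@fubini_tonelli _ _ _ _ _ P lebesgue_measure F1 mF1 F10).
rewrite (@fubini_tonelli _ _ _ _ _ P lebesgue_measure F2 mF2 F20).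
apply: ge0_le_integral => //.
- by move=> l _; apply: integral_ge0.
- exact: measurable_fun_fubini_tonelli_G.
- exact: measurable_fun_fubini_tonelli_G.
move=> l _; pose g w := W w * phi w l * expR (- (l ^+ 2 / 2)).
have g0 w : 0 <= g w by rewrite !mulr_ge0// expR_ge0.
have mg : measurable_wrt G g.
  apply/measurable_wrtP => //; apply: measurable_funM => //.
  by apply/measurable_wrtP.
have me : measurable_fun setT (fun w => expR (l * x w)).
  by apply: measurableT_comp => //; exact: measurable_funM.
have h := @ge0_integral_cond_le G sG GM (fun w => expR (l * x w)) g (expR (l ^+ 2 / 2))
  (fun=> expR_ge0 _) me (expR_ge0 _) (xsub l) g0 mg.
rewrite (_ : (fun w => F1 (w, l)) = (fun w => (g w * expR (l * x w))%:E)); last first.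
  apply/funext => w; rewrite /F1 /g /=; congr EFin.
  by rewrite expRD mulrA mulrAC.
apply: (le_trans h).
rewrite -ge0_integralZr//.
- rewrite le_eqVlt; apply/orP; left; apply/eqP; apply: eq_integral => w _.
  rewrite /g /F2 /= -EFinM; congr EFin.
  by rewrite -[LHS]mulrA -expRD addNr expR0 mulr1.
- by apply/measurable_EFinP; exact: toO.
- by move=> w _; rewrite lee_fin.
Qed.

Lemma gaussian_mixture_step (W a b : Omega -> R) :
  measurable_wrt G W -> measurable_wrt G a -> measurable_wrt G b ->
  (forall w, 0 <= W w) -> (forall w, 0 <= a w) -> (forall w, a w = 0 -> b w = 0) ->
  (\int[P]_w (W w * expR ((2 * b w * x w + a w * x w ^+ 2 - b w ^+ 2) /
        (2 * (1 + a w)) - ln (1 + a w) / 2))%:E <= \int[P]_w (W w)%:E)%E.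
Proof.
move=> mW ma mb W0 a0 ab0.
have toO (f : Omega -> R) : measurable_wrt G f -> measurable_fun [set: Omega] f.
  exact: measurable_wrt_measurable.
pose Z := a @^-1` [set 0].
have GZ : G Z by apply: ma.
pose i0 : Omega -> R := \1_Z.
have mi0 : measurable_wrt G i0.
  apply/measurable_wrtP => //; apply: measurable_indic.
  by rewrite /measurable /= sigma_algebra_id.
pose a' w := a w + i0 w; pose W' w := W w * (1 - i0 w).
have i0E w : i0 w = (a w == 0)%:R.
  rewrite /i0 indicE; congr (nat_of_bool _)%:R.
  by apply/idP/eqP => [/set_mem|h]; [|exact/mem_set].
have ma' : measurable_wrt G a'.
  by apply/measurable_wrtP => //; apply: measurable_funD; apply/measurable_wrtP.
have mW' : measurable_wrt G W'.
  apply/measurable_wrtP => //; apply: measurable_funM; first exact/measurable_wrtP.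
  by apply: measurable_funB => //; apply/measurable_wrtP.
have W'0 w : 0 <= W' w.
  by rewrite mulr_ge0// i0E; case: eqP => _; rewrite ?subrr ?subr0.
have a'0 w : 0 < a' w.
  by rewrite /a' i0E; case: eqP => [->|/eqP an]; rewrite ?add0r// addr0 lt_def an a0.
have mK (f g : Omega -> R) : measurable_fun setT f -> measurable_fun setT g ->
    (forall w, 0 <= f w) -> measurable_fun setT (fun w => K (f w) (g w) (x w)).
  move=> mf mg f0; rewrite /K.
  rewrite (_ : (fun w => _) = fun w => expR ((2 * g w * x w + f w * x w ^+ 2 - g w ^+ 2)
     * (expR (- ln (1 + f w)) / 2) - ln (1 + f w) / 2)); last first.
    apply/funext => w.
    have -> // : expR (- ln (1 + f w)) / 2 = (2 * (1 + f w))^-1.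
    by rewrite expRN lnK ?posrE ?ltr_pwDl// invfM mulrC.
  apply: measurableT_comp => //; apply: measurable_funB; last first.
    apply: measurable_funM => //; apply: measurableT_comp => //.
    exact: measurable_funD.
  apply: measurable_funM; last first.
    apply: measurable_funM => //; apply: measurableT_comp => //.
    apply: measurable_funN; apply: measurableT_comp => //; exact: measurable_funD.
  apply: measurable_funB; last exact: measurable_funX.
  apply: measurable_funD; first by do 2 apply: measurable_funM => //.
  by apply: measurable_funM => //; exact: measurable_funX.
have split (f : Omega -> R) : (forall w, 0 <= f w) -> measurable_fun setT f ->
   (\int[P]_w (W' w * f w + W w * i0 w)%:E =
    \int[P]_w (W' w * f w)%:E + \int[P]_w (W w * i0 w)%:E)%E.
  move=> f0 mf; under eq_integral do rewrite EFinD.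
  rewrite ge0_integralD//.
  - by move=> w _; rewrite lee_fin mulr_ge0.
  - by apply/measurable_EFinP; apply: measurable_funM => //; exact: toO.
  - by move=> w _; rewrite lee_fin mulr_ge0// i0E.
  - by apply/measurable_EFinP; apply: measurable_funM; exact: toO.
rewrite (eq_integral (fun w => (W' w * K (a' w) (b w) (x w) + W w * i0 w)%:E)); last first.
  move=> w _; congr EFin; rewrite /W' /a' /K i0E.
  have [aw|aw] := eqVneq (a w) 0.
    rewrite aw ab0//= subrr mulr0 !mul0r mulr1 add0r !mulr0 expr0n /= subr0 mul0r.
    by rewrite addr0 ln1 !mul0r subr0 expR0 mulr1 add0r.
  by rewrite subr0 mulr1 mulr0 !addr0.
rewrite split; last 2 first.
- by move=> w; exact: expR_ge0.
- by apply: mK; [exact: toO|exact: toO|move=> w; exact: ltW].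
apply: (@le_trans _ _ (\int[P]_w (W' w * 1)%:E + \int[P]_w (W w * i0 w)%:E)%E).
  rewrite leeD2r//; under [leRHS]eq_integral do rewrite mulr1.
  exact: step_gt0.
rewrite -(split (cst 1))//.
rewrite le_eqVlt; apply/orP; left; apply/eqP; apply: eq_integral => w _ /=.
by rewrite mulr1 -mulrDr subrK mulr1.
Qed.

End OneStep.

End ConditionalSubgaussian.

Section SelfNormalized.
Context {R : realType} {d : measure_display} {Omega : measurableType d}.
Variable P : probability Omega R.

Definition mx_measurable_wrt (G : set (set Omega)) (a b : nat)
    (A : Omega -> 'M[R]_(a, b)) : Prop :=
  forall i j, measurable_wrt G (fun w => A w i j).

Section Closure.
Variable G : set (set Omega).
Hypothesis sG : sigma_algebra setT G.

Lemma mx_measurable_wrt_cst a b (A : 'M[R]_(a, b)) :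
  mx_measurable_wrt G (fun=> A).
Proof. by move=> i j; apply/measurable_wrtP. Qed.

Lemma mx_measurable_wrtD a b (A B : Omega -> 'M[R]_(a, b)) :
  mx_measurable_wrt G A -> mx_measurable_wrt G B ->
  mx_measurable_wrt G (fun w => A w + B w).
Proof.
move=> mA mB i j; under eq_fun do rewrite mxE.
by apply/measurable_wrtP => //; apply: measurable_funD; apply/measurable_wrtP.
Qed.

Lemma mx_measurable_wrtZ a b (c : Omega -> R) (A : Omega -> 'M[R]_(a, b)) :
  measurable_wrt G c -> mx_measurable_wrt G A ->
  mx_measurable_wrt G (fun w => c w *: A w).
Proof.
move=> mc mA i j; under eq_fun do rewrite mxE.
by apply/measurable_wrtP => //; apply: measurable_funM; apply/measurable_wrtP.
Qed.

Lemma mx_measurable_wrtM a b c (A : Omega -> 'M[R]_(a, b)) (B : Omega -> 'M[R]_(b, c)) :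
  mx_measurable_wrt G A -> mx_measurable_wrt G B ->
  mx_measurable_wrt G (fun w => A w *m B w).
Proof.
move=> mA mB i j; under eq_fun do rewrite mxE.
apply/measurable_wrtP => //; apply: measurable_sum => k.
by apply: measurable_funM; apply/measurable_wrtP.
Qed.

Lemma mx_measurable_wrt_trmx a b (A : Omega -> 'M[R]_(a, b)) :
  mx_measurable_wrt G A -> mx_measurable_wrt G (fun w => (A w)^T).
Proof.
move=> mA i j; rewrite (_ : (fun w => _) = fun w => A w j i) //.
by apply/funext => w; rewrite mxE.
Qed.

End Closure.

Variable m : nat.
Variable G : nat -> set (set Omega).
Hypothesis sG : forall n, sigma_algebra setT (G n).
Hypothesis GM : forall n, G n `<=` measurable.
Hypothesis GS : forall n, G n `<=` G n.+1.
Variables (e : nat -> Omega -> 'cV[R]_m) (x : nat -> Omega -> R) (V0 : 'M[R]_m).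
Hypothesis V0p : mx_posdef V0.
Hypothesis me : forall n, mx_measurable_wrt (G n) (e n).
Hypothesis mx : forall n, measurable_wrt (G n.+1) (x n).
Hypothesis xsub : forall n, cond_subgaussian P (G n) (x n).

Definition gram_sum n w : 'M[R]_m := V0 + \sum_(i < n) e i w *m (e i w)^T.

Definition weighted_sum n w : 'cV[R]_m := \sum_(i < n) x i w *: e i w.

Definition exp_process n w : R :=
  expR (((weighted_sum n w)^T *m invmx (gram_sum n w) *m weighted_sum n w) 0 0 / 2
        - ln (\det (gram_sum n w) / \det V0) / 2).

Let gram_sumS n w : gram_sum n.+1 w = gram_sum n w + e n w *m (e n w)^T.
Proof. by rewrite /gram_sum big_ord_recr addrA. Qed.

Let weighted_sumS n w : weighted_sum n.+1 w = weighted_sum n w + x n w *: e n w.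
Proof. by rewrite /weighted_sum big_ord_recr. Qed.

Lemma gram_sum_posdef n w : mx_posdef (gram_sum n w).
Proof.
elim: n => [|n IH]; first by rewrite /gram_sum big_ord0 addr0.
by rewrite gram_sumS; exact: mx_posdefD_rank1.
Qed.

Let a n w : R := ((e n w)^T *m invmx (gram_sum n w) *m e n w) 0 0.
Let b n w : R := ((e n w)^T *m invmx (gram_sum n w) *m weighted_sum n w) 0 0.

Let a_ge0 n w : 0 <= a n w.
Proof. exact/quad_inv_ge0/gram_sum_posdef. Qed.

Let mx_measurable_wrtS n p q (A : Omega -> 'M[R]_(p, q)) :
  mx_measurable_wrt (G n) A -> mx_measurable_wrt (G n.+1) A.
Proof. by move=> mA i j; apply: measurable_wrt_le (mA i j); exact: GS. Qed.

Let measurable_weighted_sum n : mx_measurable_wrt (G n) (weighted_sum n).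
Proof.
elim: n => [|n IH].
  rewrite (_ : weighted_sum 0 = fun=> 0); first exact: mx_measurable_wrt_cst.
  by apply/funext => w; rewrite /weighted_sum big_ord0.
rewrite (_ : weighted_sum n.+1 = fun w => weighted_sum n w + x n w *: e n w); last first.
  by apply/funext => w; exact: weighted_sumS.
apply: mx_measurable_wrtD => //; first exact: mx_measurable_wrtS.
by apply: mx_measurable_wrtZ => //; exact: mx_measurable_wrtS.
Qed.

Let measurable_inv n : mx_measurable_wrt (G n) (fun w => invmx (gram_sum n w)).
Proof.
elim: n => [|n IH].
  rewrite (_ : (fun w => _) = fun=> invmx V0); first exact: mx_measurable_wrt_cst.
  by apply/funext => w; rewrite /gram_sum big_ord0 addr0.
rewrite (_ : (fun w => _) = fun w => invmx (gram_sum n w) +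
   (- expR (- ln (1 + a n w))) *: ((invmx (gram_sum n w) *m e n w) *m
      (invmx (gram_sum n w) *m e n w)^T)); last first.
  apply/funext => w; rewrite gram_sumS invmx_rank1; last exact: gram_sum_posdef.
  by rewrite scaleNr expRN lnK// posrE ltr_pwDl// a_ge0.
have ma : measurable_wrt (G n) (a n).
  by do 2 apply: mx_measurable_wrtM => //; exact: mx_measurable_wrt_trmx.
have mQe : mx_measurable_wrt (G n) (fun w => invmx (gram_sum n w) *m e n w).
  exact: mx_measurable_wrtM.
apply: mx_measurable_wrtS; apply: mx_measurable_wrtD => //.
apply: mx_measurable_wrtZ => //.
  apply/measurable_wrtP => //; apply: measurable_funN; apply: measurableT_comp => //.
  apply: measurable_funN; apply: measurableT_comp => //.
  by apply: measurable_funD => //; exact/measurable_wrtP.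
by apply: mx_measurable_wrtM => //; exact: mx_measurable_wrt_trmx.
Qed.

Let measurable_a n : measurable_wrt (G n) (a n).
Proof. by do 2 apply: mx_measurable_wrtM => //; exact: mx_measurable_wrt_trmx. Qed.

Let measurable_b n : measurable_wrt (G n) (b n).
Proof. by do 2 apply: mx_measurable_wrtM => //; exact: mx_measurable_wrt_trmx. Qed.

Let exp_processS n w : exp_process n.+1 w = exp_process n w *
  expR ((2 * b n w * x n w + a n w * x n w ^+ 2 - b n w ^+ 2) /
        (2 * (1 + a n w)) - ln (1 + a n w) / 2).
Proof.
have Vp := gram_sum_posdef n w.
have /andP[V00 _] := hadamard_posdef V0p; have /andP[Vn0 _] := hadamard_posdef Vp.
have a1 : 0 < 1 + a n w by rewrite ltr_pwDl// a_ge0.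
rewrite /exp_process weighted_sumS gram_sumS quad_rank1// det_rank1//.
rewrite -/(a n w) -/(b n w) -expRD; congr expR.
have -> : ln (\det (gram_sum n w) * (1 + a n w) / \det V0) =
    ln (\det (gram_sum n w) / \det V0) + ln (1 + a n w).
  by rewrite mulrAC lnM ?posrE ?divr_gt0.
by field; rewrite gt_eqF.
Qed.

Lemma det_gram_sum_ge n w : \det V0 <= \det (gram_sum n w).
Proof.
elim: n => [|n IH]; first by rewrite /gram_sum big_ord0 addr0.
have Vp := gram_sum_posdef n w; have /andP[Vn0 _] := hadamard_posdef Vp.
rewrite gram_sumS det_rank1//; apply: (le_trans IH).
by apply: ler_peMr; rewrite ?lerDl ?(ltW Vn0)//; exact: a_ge0.
Qed.

Lemma measurable_exp_process n : measurable_wrt (G n) (exp_process n).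
Proof.
elim: n => [|n IH].
  rewrite (_ : exp_process 0 = fun=> 1); first exact/measurable_wrtP.
  apply/funext => w; rewrite /exp_process /weighted_sum /gram_sum !big_ord0 addr0.
  rewrite mulmx0 mxE divff ?ln1 ?mul0r ?subr0 ?expR0//.
  by have /andP[V00 _] := hadamard_posdef V0p; rewrite gt_eqF.
rewrite (_ : exp_process n.+1 = fun w => exp_process n w *
  expR ((2 * b n w * x n w + a n w * x n w ^+ 2 - b n w ^+ 2) *
        (expR (- ln (1 + a n w)) / 2) - ln (1 + a n w) / 2)); last first.
  apply/funext => w; rewrite exp_processS.
  have -> // : expR (- ln (1 + a n w)) / 2 = (2 * (1 + a n w))^-1.
  by rewrite expRN lnK ?posrE ?ltr_pwDl ?a_ge0// invfM mulrC.
have mx' : measurable_fun setT (x n : g_sigma_algebraType (G n.+1) -> R).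
  exact/measurable_wrtP.
have ma' : measurable_fun setT (a n : g_sigma_algebraType (G n.+1) -> R).
  by apply/measurable_wrtP => //; apply: measurable_wrt_le (measurable_a n); exact: GS.
have mb' : measurable_fun setT (b n : g_sigma_algebraType (G n.+1) -> R).
  by apply/measurable_wrtP => //; apply: measurable_wrt_le (measurable_b n); exact: GS.
apply/measurable_wrtP => //; apply: measurable_funM.
  by apply/measurable_wrtP => //; apply: measurable_wrt_le IH; exact: GS.
apply: measurableT_comp => //; apply: measurable_funB; last first.
  by apply: measurable_funM => //; apply: measurableT_comp => //; exact: measurable_funD.
apply: measurable_funM; last first.
  apply: measurable_funM => //; apply: measurableT_comp => //.
  by apply: measurable_funN; apply: measurableT_comp => //; exact: measurable_funD.
apply: measurable_funB; last exact: measurable_funX.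
apply: measurable_funD; first by do 2 apply: measurable_funM => //.
by apply: measurable_funM => //; exact: measurable_funX.
Qed.

(* The method of mixtures, one rank-one update at a time. *)
Lemma exp_process_integral_le1 n : (\int[P]_w (exp_process n w)%:E <= 1)%E.
Proof.
elim: n => [|n IH].
  rewrite (eq_integral (cst 1%E)).
    by rewrite integral_cst// mul1e; exact: probability_le1.
  move=> w _; rewrite /exp_process /weighted_sum /gram_sum !big_ord0 addr0.
  rewrite mulmx0 mxE divff ?ln1 ?mul0r ?subr0 ?expR0//.
  by have /andP[V00 _] := hadamard_posdef V0p; rewrite gt_eqF.
under eq_integral do rewrite exp_processS.
apply: le_trans IH; apply: (gaussian_mixture_step (sG n)) => //.
- by apply: measurable_wrt_measurable (mx n); exact: GM.
- exact: measurable_exp_process.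
- by move=> w; exact: expR_ge0.
- move=> w a0; rewrite /b (quad_inv_eq0 (gram_sum_posdef n w) a0).
  by rewrite trmx0 !mul0mx mxE.
Qed.

End SelfNormalized.

Section Blocks.
Variable R : realType.

Lemma mx_opnorm_blocks (q T p : nat) (M : 'M[R]_(q, T * p)) (A : 'I_T -> 'M[R]_(q, p)) :
  (forall i k l, M i (mxvec_index k l) = A k i l) ->
  mx_opnorm M ^+ 2 <= \sum_k mx_opnorm (A k) ^+ 2.
Proof.
move=> MA; set s := \sum_k _.
have s0 : 0 <= s by apply: sumr_ge0 => k _; exact: sqr_ge0.
suff : mx_opnorm M <= Num.sqrt s.
  move=> h; rewrite -[leRHS]sqr_sqrtr// lerXn2r ?nnegrE ?mx_opnorm_ge0 ?sqrtr_ge0//.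
apply: mx_opnorm_leP => [|x]; first exact: sqrtr_ge0.
pose y k : 'cV[R]_p := \col_l x (mxvec_index k l) 0.
have sumE (f : 'I_(T * p) -> R) : \sum_j f j = \sum_k \sum_l f (mxvec_index k l).
  rewrite (reindex _ (curry_mxvec_bij T p)) /= pair_bigA /=.
  by apply: eq_bigr => -[k l] _.
have -> : M *m x = \sum_k A k *m y k.
  apply/matrixP => i j; rewrite ord1 summxE mxE sumE; apply: eq_bigr => k _.
  by rewrite mxE; apply: eq_bigr => l _; rewrite MA mxE.
apply: (le_trans (ler_mx_norm2_sum _ _)).
apply: (@le_trans _ _ (\sum_k mx_opnorm (A k) * mx_norm2 (y k))).
  by apply: ler_sum => k _; exact: mx_opnorm_ub.
apply: (le_trans (cauchy_schwarz_sum _ _)).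
suff -> : Num.sqrt (\sum_i mx_norm2 (y i) ^+ 2) = mx_norm2 x by [].
congr Num.sqrt; rewrite sumE; apply: eq_bigr => k _; rewrite mx_norm2_sqr.
by apply: eq_bigr => l _; rewrite mxE.
Qed.

(* Jensen's inequality for the exponential replaces a union bound over the
   blocks, so no [ln T] is lost. *)
Lemma sum_opnorm_le (q T p : nat) (A : 'I_T -> 'M[R]_(q, p)) (s : seq 'cV[R]_p) (c : R) :
  (0 < size s)%N ->
  (forall (M : 'M[R]_(q, p)) (B : R),
     {in s, forall z, mx_norm2 (M *m z) <= B} -> mx_opnorm M <= 2 * B) ->
  \sum_k \sum_(z <- s) expR (mx_norm2 (A k *m z) ^+ 2 / 2) <= T%:R * expR c ->
  \sum_k mx_opnorm (A k) ^+ 2 <= 8 * T%:R * c.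
Proof.
move=> s0 net h.
pose Y k := \sum_(z <- s) expR (mx_norm2 (A k *m z) ^+ 2 / 2).
have Yge k z : z \in s -> expR (mx_norm2 (A k *m z) ^+ 2 / 2) <= Y k.
  move=> zs; rewrite /Y (big_rem z)//= lerDl.
  by apply: sumr_ge0 => ? _; exact: expR_ge0.
have Y1 k : 1 <= Y k.
  case: s s0 @Y Yge {net h} => [//|z s] _ Y Yge.
  apply: (le_trans _ (Yge k z (mem_head _ _))).
  by rewrite -expR0 ler_expR divr_ge0// sqr_ge0.
have Y0 k : 0 < Y k by apply: lt_le_trans (Y1 k).
have lY0 k : 0 <= ln (Y k) by exact: ln_ge0.
have Ak k : mx_opnorm (A k) ^+ 2 <= 8 * ln (Y k).
  have hB : mx_opnorm (A k) <= 2 * Num.sqrt (2 * ln (Y k)).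
    apply: net => z zs; rewrite -[leLHS]ger0_norm ?mx_norm2_ge0// -sqrtr_sqr.
    rewrite ler_wsqrtr// -ler_pdivrMl// mulrC -ler_expR lnK ?posrE//.
    exact: Yge.
  apply: (@le_trans _ _ ((2 * Num.sqrt (2 * ln (Y k))) ^+ 2)).
    by rewrite lerXn2r ?nnegrE ?mx_opnorm_ge0 ?mulr_ge0 ?sqrtr_ge0.
  by rewrite exprMn sqr_sqrtr ?mulr_ge0// mulrA -natrX -natrM.
apply: (le_trans (ler_sum _ (fun k _ => Ak k))).
rewrite -mulr_sumr -mulrA ler_wpM2l//.
apply: (@le_trans _ _ (\sum_k (Y k * expR (- c) + (c - 1)))).
  apply: ler_sum => k _.
  have p0 : 0 < Y k * expR (- c) by rewrite mulr_gt0 ?expR_gt0.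
  have := @le_ln1Dx R (Y k * expR (- c) - 1).
  rewrite ltrBrDl subrr p0 => /(_ isT); rewrite addrC subrK.
  rewrite lnM ?posrE ?expR_gt0// expRK; lra.
rewrite big_split /= -mulr_suml sumr_const card_ord -[(c - 1) *+ T]mulr_natl.
have : (\sum_k Y k) * expR (- c) <= T%:R.
  by rewrite expRN ler_pdivrMr ?expR_gt0.
by rewrite mulrBr mulr1; lra.
Qed.

End Blocks.

Section Markov.
Context {R : realType} {d : measure_display} {Omega : measurableType d}.
Variable P : probability Omega R.

Lemma markov_event (S : Omega -> R) (c delta : R) :
  measurable_fun setT S -> (forall w, 0 <= S w) -> 0 < c -> 0 < delta ->
  (\int[P]_w (S w)%:E <= c%:E)%E ->
  measurable [set w | S w <= c / delta] /\
  ((1 - delta)%:E <= P [set w | (S w <= c / delta)%R])%E.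
Proof.
move=> mS S0 c0 d0 hS; set a := c / delta; set B := [set w | _].
have a0 : 0 < a by rewrite divr_gt0.
have mB : measurable B.
  rewrite (_ : B = setT `&` S @^-1` `]-oo, a]%classic); first exact: mS.
  by rewrite setTI; apply/seteqP; split => w /=; rewrite in_itv.
split => //.
have mk := @le_integral_comp_abse _ _ _ P setT measurableT (EFin \o S) a id
  (@measurable_id _ _ _) (fun r h => h) (fun _ _ _ _ h => h).
have {}mk := mk _ a0.
have hB : (a%:E * P (~` B) <= c%:E)%E.
  apply: (@le_trans _ _ (a%:E * P (setT `&` [set w | (a%:E <= `|(S w)%:E|)%E]))%E).
    rewrite lee_pmul2l ?lte_fin//; apply: le_measure.
    - exact/mem_set/measurableC.
    - apply/mem_set; rewrite (_ : [set w | _] = S @^-1` `[a, +oo[%classic); first exact: mS.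
      by apply/seteqP; split => w /=; rewrite in_itv /= andbT lee_fin ger0_norm.
    - move=> w /= /negP; rewrite -ltNge => h; split => //.
      by rewrite lee_fin ger0_norm// ltW.
  apply: le_trans hS; apply: (le_trans (mk _)); first exact/measurable_EFinP.
  rewrite le_eqVlt; apply/orP; left; apply/eqP; apply: eq_integral => w _ /=.
  by rewrite ger0_norm.
have PC : P (~` B) = (fine (P (~` B)))%:E.
  by rewrite fineK// fin_num_measure//; exact: measurableC.
rewrite PC -EFinM lee_fin mulrC -ler_pdivlMr// /a invf_div mulrCA divff ?gt_eqF// mulr1 in hB.
have -> : P B = (1 - P (~` B))%E by rewrite -probability_setC ?setCK//; exact: measurableC.
by rewrite PC -EFinB lee_fin; lra.
Qed.

End Markov.

Section Stitching.
Variable R : realType.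

Lemma countable_event_bound (d : measure_display) (Omega : measurableType d)
    (P : probability Omega R) (E : nat -> set Omega) (delta : R) : 0 <= delta ->
  (forall j, measurable (E j)) ->
  (forall j, ((1 - delta / (j.+1 * j.+2)%:R)%:E <= P (E j))%E) ->
  measurable (\bigcap_j E j) /\ ((1 - delta)%:E <= P (\bigcap_j E j))%E.
Proof.
move=> d0 mE PE.
have mI : measurable (\bigcap_j E j) by exact: bigcapT_measurable.
split => //.
have mC j : measurable (~` E j) by exact: measurableC.
have PC j : (P (~` E j) <= (delta / (j.+1 * j.+2)%:R)%:E)%E.
  rewrite probability_setC//; move: (PE j).
  rewrite -(fineK (fin_num_measure P _ (mE j))) -EFinB !lee_fin.
  by rewrite !lerBlDr addrC.
have hC : (P (~` \bigcap_j E j) <= delta%:E)%E.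
  rewrite setC_bigcap.
  apply: (@le_trans _ _ (\sum_(0 <= j <oo) P (~` E j))%E).
    apply: measure_sigma_subadditive => //.
    exact: bigcupT_measurable.
  apply: lime_le; first by apply: is_cvg_nneseries => j _ _.
  apply: nearW => K.
  apply: (@le_trans _ _ (\sum_(0 <= j < K) (delta / (j.+1 * j.+2)%:R)%:E)%E).
    by apply: lee_sum => j _; exact: PC.
  rewrite sumEFin lee_fin.
  suff -> : \sum_(0 <= j < K) delta / (j.+1 * j.+2)%:R = delta - delta / K.+1%:R.
    by rewrite gerBl divr_ge0.
  elim: K => [|K IH]; first by rewrite big_geq// divr1 subrr.
  rewrite big_nat_recr//= IH natrM -!natr1.
  have K0 : 0 <= K%:R :> R by [].
  by field; rewrite !gt_eqF//; lra.
have mIC : measurable (~` \bigcap_j E j) by exact: measurableC.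
have -> : P (\bigcap_j E j) = (1 - P (~` \bigcap_j E j))%E.
  by rewrite -probability_setC ?setCK.
move: hC; rewrite -(fineK (fin_num_measure P _ mIC)) -EFinB !lee_fin; lra.
Qed.

Lemma lil_ge0 (x : R) : 0 <= x -> 0 <= lil x.
Proof.
by move=> x0; rewrite /lil ln_ge0// lerDl ln_ge0// lerDl.
Qed.

Lemma dyadic_scale (kappa x : R) : 0 < kappa -> 0 <= x ->
  exists j : nat, [/\ x <= kappa * 2 ^+ j, kappa * 2 ^+ j <= 2 * (x + kappa) &
    ln (j.+1 * j.+2)%:R <= 4 + 2 * lil (x / kappa)].
Proof.
move=> k0 x0; set y := x / kappa.
have y0 : 0 <= y by rewrite divr_ge0// ltW.
have xE : x = y * kappa by rewrite divfK// gt_eqF.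
have ex : exists j, x <= kappa * 2 ^+ j.
  exists (Num.truncn y).+1; rewrite xE mulrC ler_pM2l//.
  apply: (@le_trans _ _ (Num.truncn y).+1%:R).
    by apply/ltW; case/andP: (truncn_itv y0).
  by rewrite -natrX ler_nat ltnW// ltn_expl.
case: (ex_minnP ex) => j hj jmin; exists j.
set q := ln (1 + y).
have q0 : 0 <= q by rewrite ln_ge0// lerDl.
have jP : (j == 0)%N \/ (0 < j)%N /\ kappa * 2 ^+ j.-1 < x.
  case: j hj jmin => [|j] _ jmin; [by left|right; split => //=].
  by rewrite ltNge; apply/negP => /jmin; rewrite ltnn.
have j2 : j.+2%:R <= 3 * (1 + q).
  case: jP => [/eqP ->|[jp hx]]; first by lra.
  have h2 : 2 ^+ j.-1 <= 1 + y.
    move: hx; rewrite xE mulrC ltr_pM2r// => hx.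
    by apply/ltW; apply: (lt_le_trans hx); rewrite lerDr.
  have hq : ln 2 * j.-1%:R <= q.
    by rewrite mulr_natr -lnXn// ler_ln ?posrE ?exprn_gt0// ltr_pwDl.
  have hl : 2^-1 * j.-1%:R <= ln 2 * j.-1%:R :> R by rewrite ler_wpM2r// half_le_ln2.
  have -> : j.+2%:R = j.-1%:R + 3 :> R by rewrite -[in LHS](prednK jp) -natrD addn3.
  by lra.
split => //.
- case: jP => [/eqP ->|[jp hx]]; first by rewrite expr0; lra.
  by rewrite -(prednK jp) exprS mulrCA; lra.
- have q1 : 0 < 1 + q by rewrite ltr_pwDl.
  apply: (@le_trans _ _ (ln ((3 * (1 + q)) ^+ 2))).
    rewrite ler_ln ?posrE ?exprn_gt0 ?mulr_gt0// ?ltr0n//.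
    rewrite natrM expr2 ler_pM//; apply: (le_trans _ j2).
    by rewrite ler_nat.
  rewrite lnXn ?mulr_gt0// lnM ?posrE// -/q.
  have : ln 3 <= 2 :> R.
    have := @le_ln1Dx R 2; rewrite (_ : 1 + 2 = 3 :> R); last by ring.
    by apply; lra.
  rewrite /lil -/y -/q; lra.
Qed.

Section GramFactor.
Variables (n m : nat) (D : 'M[R]_(n, m)) (s : R).
Hypothesis s0 : 0 < s.
Let V := (s ^+ 2)%:M + D^T *m D.
Let M := col_mx D s%:M.

Definition gram_factor : 'M[R]_(n + m, m) := M *m invmx V.

Let MM : M^T *m M = V.
Proof.
rewrite /M tr_col_mx mul_row_col tr_scalar_mx mul_scalar_mx scale_scalar_mx.
by rewrite -expr2 addrC.
Qed.

Let Vp : mx_posdef V.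
Proof. by apply: mx_posdefD_gram; apply: mx_posdef_scalar; rewrite exprn_gt0. Qed.

Lemma gram_factorE : gram_factor^T *m gram_factor = invmx V.
Proof.
rewrite /gram_factor trmx_mul (mx_posdef_inv Vp).1 -mulmxA (mulmxA M^T) MM.
by rewrite mulmxV ?mulmx1// mx_posdef_unit.
Qed.

Lemma gram_factor_opnorm q (A : 'M[R]_(m, q)) : mx_opnorm D <= s ->
  mx_opnorm A ^+ 2 <= 2 * s ^+ 2 * mx_opnorm (gram_factor *m A) ^+ 2.
Proof.
move=> Ds.
have sE : Num.sqrt (2 * s ^+ 2) ^+ 2 = 2 * s ^+ 2.
  by rewrite sqr_sqrtr// mulr_ge0// sqr_ge0.
have Mn : mx_opnorm M <= Num.sqrt (2 * s ^+ 2).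
  apply: mx_opnorm_leP => [|y]; first exact: sqrtr_ge0.
  rewrite -(@ler_pXn2r _ 2)// ?nnegrE ?mx_norm2_ge0 ?mulr_ge0 ?sqrtr_ge0 ?mx_norm2_ge0//.
  rewrite exprMn sE.
  have -> : mx_norm2 (M *m y) ^+ 2 = mx_norm2 (D *m y) ^+ 2 + mx_norm2 (s *: y) ^+ 2.
    rewrite /M mul_col_mx mul_scalar_mx !mx_norm2_sqr big_split_ord /=.
    by congr (_ + _); apply: eq_bigr => i _; rewrite ?col_mxEu ?col_mxEd.
  have h1 : mx_norm2 (D *m y) ^+ 2 <= (s * mx_norm2 y) ^+ 2.
    rewrite lerXn2r ?nnegrE ?mulr_ge0 ?mx_norm2_ge0 ?(ltW s0)//.
    apply: (le_trans (mx_opnorm_ub _ _)).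
    by rewrite ler_wpM2r ?mx_norm2_ge0.
  move: h1; rewrite mx_norm2Z gtr0_norm// !exprMn; lra.
have AE : A = M^T *m (gram_factor *m A).
  by rewrite /gram_factor !mulmxA MM mulmxV ?mul1mx// mx_posdef_unit.
rewrite -sE -exprMn lerXn2r ?nnegrE ?mulr_ge0 ?sqrtr_ge0 ?mx_opnorm_ge0//.
rewrite {1}AE; apply: (le_trans (mx_opnormM _ _)).
by rewrite ler_wpM2r ?mx_opnorm_ge0// mx_opnorm_trmx.
Qed.

End GramFactor.

Lemma sqrt_bound (x c t y : R) : 0 <= x -> 0 <= c -> 0 <= t ->
  x ^+ 2 <= c ^+ 2 * t * y -> x <= c * Num.sqrt t * Num.sqrt y.
Proof.
move=> x0 c0 t0 h; rewrite -[x]ger0_norm// -sqrtr_sqr.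
apply: (le_trans (ler_wsqrtr h)); rewrite sqrtrM ?mulr_ge0 ?sqr_ge0//.
by rewrite sqrtrM ?sqr_ge0// sqrtr_sqr ger0_norm.
Qed.

(* The root selected by [mx_sqrtm] is either a genuine one or the default [0]. *)
Lemma mx_sqrtm_inv_gram m (V : 'M[R]_m) : (0 < m)%N -> mx_posdef V ->
  let L := invmx (mx_sqrtm V) in L = 0 \/ L^T *m L = invmx V.
Proof.
move=> m0 Vp; rewrite /mx_sqrtm; case: xgetP => [S _ [[Ss _] SS]|_] /=; [right|left].
  have Su : S \in unitmx.
    have := mx_posdef_unit Vp.
    by rewrite !unitmxE -SS det_mulmx unitrM => /andP[].
  rewrite trmx_inv Ss; apply/esym/invmx_uniq.
  by rewrite -SS mulmxA -(mulmxA S S) mulmxV// mulmx1 mulmxV.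
rewrite /invmx unitmxE; case: m m0 V {Vp} => // m _ _.
by rewrite det0 unitr0.
Qed.

End Stitching.

Section Regression.
Context {R : realType} {d : measure_display} {Omega : measurableType d}.
Variables (P : probability Omega R) (p m T N1 N : nat).
Variables (F : int -> set (set Omega)) (u : int -> Omega -> 'cV[R]_p)
  (dl : int -> Omega -> 'cV[R]_m).
Hypotheses (p0 : (0 < p)%N) (T0 : (0 < T)%N).
Hypothesis filF : filtration F.
Hypothesis mu : forall t (l : 'I_p), measurable_wrt (F t) (fun w => u t w l 0).
Hypothesis usub : forall t (v : 'cV[R]_p) (A : set Omega), F (t - 1) A ->
  (\int[P]_(w in A) (expR (\sum_(l < p) v l 0 * u t w l 0))%:E
     <= P A * (expR (mx_norm2 v ^+ 2 / 2))%:E)%E.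
Hypothesis mdl : forall t (j : 'I_m),
  measurable_wrt (F (t - T%:Z)) (fun w => dl t w j 0).

Let lag (k : nat) (z : 'cV[R]_p) (i : nat) (w : Omega) : R :=
  \sum_(l < p) z l 0 * u (N1%:Z + i%:Z - k%:Z) w l 0.
Let lagF (k i : nat) := F (N1%:Z + i%:Z - k%:Z - 1).
Let e (i : nat) := dl (N1%:Z + i%:Z).

Let lagF_sigma k i : sigma_algebra setT (lagF k i).
Proof. by have [h _] := filF; exact: h. Qed.

Let lagF_measurable k i : lagF k i `<=` measurable.
Proof. by have [_ [h _]] := filF; exact: h. Qed.

Let lagF_mono k i : lagF k i `<=` lagF k i.+1.
Proof. by case: filF => _ [_]; apply; lia. Qed.

Let e_measurable k : (k < T)%N -> forall i, mx_measurable_wrt (lagF k i) (e i).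
Proof.
move=> kT i j j'; rewrite ord1; apply: measurable_wrt_le (mdl _ j).
by case: filF => _ [_]; apply; lia.
Qed.

Let lag_measurable k z i : measurable_wrt (lagF k i.+1) (lag k z i).
Proof.
apply/measurable_wrtP => //; rewrite /lag; apply: measurable_sum => l.
apply: measurable_funM => //; apply/measurable_wrtP => //.
apply: measurable_wrt_le (mu _ l).
by case: filF => _ [_]; apply; lia.
Qed.

Let lag_subgaussian k z i : mx_norm2 z <= 1 -> cond_subgaussian P (lagF k i) (lag k z i).
Proof.
move=> z1 l A GA.
rewrite (eq_integral (fun w => (expR (\sum_(j < p) (l *: z) j 0 *
    u (N1%:Z + i%:Z - k%:Z) w j 0))%:E)); last first.
  move=> w _; rewrite /lag mulr_sumr; congr (expR _)%:E.
  by apply: eq_bigr => j _; rewrite mxE mulrA.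
apply: (le_trans (usub (l *: z) GA)).
rewrite lee_wpmul2l// lee_fin ler_expR ler_pM2r// mx_norm2Z exprMn.
by rewrite real_normK ?num_real// ler_piMr ?sqr_ge0// expr_le1// mx_norm2_ge0.
Qed.

Let n := (N - N1).+1.

Let Ulag (k : 'I_T) (w : Omega) : 'M[R]_(n, p) :=
  \matrix_(i < n, l < p) u (N1%:Z + i%:Z - k%:Z) w l 0.

Let Delta_gram w : (Delta m N1 N dl w)^T *m Delta m N1 N dl w =
  \sum_(i < n) e i w *m (e i w)^T.
Proof.
apply/matrixP => j j'; rewrite mxE summxE; apply: eq_bigr => i _.
by rewrite !mxE big_ord1 !mxE.
Qed.

Let Delta_lag (k : 'I_T) z w :
  (Delta m N1 N dl w)^T *m (Ulag k w *m z) = weighted_sum e (lag k z) n w.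
Proof.
apply/matrixP => j j'; rewrite ord1 mxE summxE; apply: eq_bigr => i _.
rewrite !mxE mulrC; congr (_ * _); rewrite /lag; apply: eq_bigr => l _.
by rewrite mxE mulrC.
Qed.

Lemma self_normalized_bound (delta : R) (V0 : 'M[R]_m) :
  0 < delta < 1 -> mx_posdef V0 ->
  exists E : set Omega, [/\ measurable E, ((1 - delta)%:E <= P E)%E &
    forall w, E w ->
      let U := Ubar p T N1 N u w in
      let D := Delta m N1 N dl w in
      0 <= ln (\det (1%:M + D *m invmx V0 *m D^T)) /\
      forall (q : nat) (L : 'M[R]_(q, m)), L^T *m L = invmx (V0 + D^T *m D) ->
      mx_opnorm (L *m (D^T *m U)) ^+ 2 <=
        8 * T%:R * (12 * ptilde p T + ln (delta^-1)
                    + ln (\det (1%:M + D *m invmx V0 *m D^T)) / 2)].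
Proof.
move=> /andP[d0 d1] V0p.
have [s [s0 s1 slog snet]] := @operator_norm_net R p p0.
pose W (k : 'I_T) z w := exp_process e (lag k z) V0 n w.
pose S w := \sum_(k < T) \sum_(z <- s) W k (if mx_norm2 z <= 1 then z else 0) w.
have sz : 0 < (size s)%:R :> R by rewrite ltr0n.
have z1 (z : 'cV[R]_p) : mx_norm2 (if mx_norm2 z <= 1 then z else 0) <= 1.
  by case: ifP => // _; rewrite mx_norm2_0.
have mW (k : 'I_T) z : measurable_fun setT (W k z).
  apply: (measurable_wrt_measurable (@lagF_measurable k n)).
  by apply: measurable_exp_process => // i; exact: e_measurable.
have W0 (k : 'I_T) z w : 0 <= W k z w by exact: expR_ge0.
have IW (k : 'I_T) z : mx_norm2 z <= 1 -> (\int[P]_w (W k z w)%:E <= 1)%E.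
  move=> hz; apply: (@exp_process_integral_le1 _ _ _ P m (lagF k)) => // i.
  - exact: e_measurable.
  - exact: lag_subgaussian.
have [|||||mE PE] := @markov_event _ _ _ P S (T%:R * (size s)%:R) delta.
- by do 2 (apply: measurable_sum => ?).
- by move=> w; apply: sumr_ge0 => k _; apply: sumr_ge0.
- by rewrite mulr_gt0// ltr0n.
- exact: d0.
- rewrite /S; under eq_integral do rewrite -sumEFin.
  rewrite ge0_integral_sum//; last 2 first.
  + by move=> k; apply/measurable_EFinP; apply: measurable_sum => ?.
  + by move=> k w _; rewrite lee_fin; apply: sumr_ge0.
  rewrite (_ : T%:R * (size s)%:R = \sum_(k < T) \sum_(z <- s) 1); last first.
    transitivity (\sum_(k < T) (size s)%:R : R).
      by rewrite sumr_const card_ord mulr_natl.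
    by apply: eq_bigr => k _; rewrite big_const_seq count_predT iter_addr_0.
  rewrite -sumEFin; apply: lee_sum => k _.
  under eq_integral do rewrite -sumEFin.
  rewrite ge0_integral_sum//; last 2 first.
  + by move=> z; apply/measurable_EFinP.
  + by move=> z w _; rewrite lee_fin.
  by rewrite -sumEFin; apply: lee_sum => z _; exact: IW.
exists [set w | S w <= T%:R * (size s)%:R / delta]; split => // w /= Sw.
set U := Ubar p T N1 N u w; set D := Delta m N1 N dl w.
have gramE : gram_sum e V0 n w = V0 + D^T *m D by rewrite Delta_gram.
have /andP[dV0 _] := hadamard_posdef V0p.
have detge : 1 <= \det (V0 + D^T *m D) / \det V0.
  by rewrite ler_pdivlMr// mul1r -gramE det_gram_sum_ge.
rewrite det_1D_gram//; set ld := ln _.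
have ld0 : 0 <= ld by exact: ln_ge0.
split => // q L LL.
pose A (k : 'I_T) := L *m (D^T *m Ulag k w).
pose c := ln (size s)%:R + ln delta^-1 + ld / 2.
apply: (@le_trans _ _ (\sum_k mx_opnorm (A k) ^+ 2)).
  apply: mx_opnorm_blocks => i k l; rewrite /A !mulmxA !mxE.
  by apply: eq_bigr => r _; congr (_ * _); rewrite !mxE mxvecE mxE.
apply: (@le_trans _ _ (8 * T%:R * c)); last first.
  rewrite ler_wpM2l ?mulr_ge0// /c !lerD2r.
  apply: (le_trans slog); case: eqP => [_|/eqP p1].
    by rewrite mulr_ge0// ptilde_ge0.
  have : p%:R / 2 <= ptilde p T :> R by apply: ptilde_ge => //; lia.
  by lra.
apply: (sum_opnorm_le s0) => [M B|]; first exact: snet.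
have -> : \sum_k \sum_(z <- s) expR (mx_norm2 (A k *m z) ^+ 2 / 2) =
    S w * expR (ld / 2).
  rewrite /S mulr_suml; apply: eq_bigr => k _; rewrite mulr_suml.
  apply: eq_big_seq => z zs; rewrite s1// /W /exp_process gramE -/ld -expRD subrK.
  congr (expR (_ / 2)); rewrite mx_norm2_dot /A -!mulmxA Delta_lag.
  by rewrite trmx_mul -!mulmxA (mulmxA L^T) LL !mulmxA.
rewrite /c 2!expRD lnK ?posrE// lnK ?posrE ?invr_gt0// !mulrA.
by rewrite ler_wpM2r// expR_ge0.
Qed.

Lemma whitened_cross_bound (delta : R) (V0 : 'M[R]_m) :
  (0 < m)%N -> 0 < delta < 1 -> mx_posdef V0 ->
  exists E : set Omega, [/\ measurable E, ((1 - delta)%:E <= P E)%E &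
    forall w, E w ->
      let U := Ubar p T N1 N u w in
      let D := Delta m N1 N dl w in
      mx_opnorm (invmx (mx_sqrtm (D^T *m D + V0)) *m (D^T *m U))
        <= 28 * Num.sqrt (T%:R) *
           Num.sqrt (ptilde p T + ln (delta^-1)
             + ln (\det (1%:M + D *m invmx V0 *m D^T)) / 2)].
Proof.
move=> m0 d01 V0p; have /andP[d0 d1] := d01.
have [E [mE PE hE]] := self_normalized_bound d01 V0p.
exists E; split => // w Ew /=; set U := Ubar _ _ _ _ _ w; set D := Delta _ _ _ _ w.
have [ld0 {}hE] := hE w Ew; rewrite -/U -/D in ld0 hE.
have TR0 : 0 <= T%:R :> R by [].
have pt0 : 0 <= ptilde p T :> R by exact: ptilde_ge0.
have del0 : 0 <= ln delta^-1 by rewrite ln_ge0// invf_ge1// ltW.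
have Vp : mx_posdef (D^T *m D + V0) by rewrite addrC; exact: mx_posdefD_gram.
apply: sqrt_bound => //; first exact: mx_opnorm_ge0.
have [->|LL] := mx_sqrtm_inv_gram m0 Vp.
  have -> : mx_opnorm ((0 : 'M[R]_m) *m (D^T *m U)) = 0.
    apply/eqP; rewrite eq_le mx_opnorm_ge0 andbT; apply: mx_opnorm_le => y _.
    by rewrite !mul0mx mx_norm2_0.
  by rewrite expr0n /= !mulr_ge0// !addr_ge0// divr_ge0.
apply: (le_trans (hE _ _ _)); first by rewrite LL addrC.
rewrite [28 ^+ 2 * _]mulrC -!mulrA [8 * _]mulrCA ler_wpM2l//; lra.
Qed.

Lemma cross_bound (delta kappa : R) : (0 < m)%N -> 0 < delta < 1 -> 0 < kappa ->
  exists E : set Omega, [/\ measurable E, ((1 - delta)%:E <= P E)%E &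
    forall w, E w ->
      let U := Ubar p T N1 N u w in
      let D := Delta m N1 N dl w in
      mx_opnorm (D^T *m U)
        <= 28 * Num.sqrt (T%:R) * (mx_opnorm D + kappa) *
           Num.sqrt (ptilde p T + m%:R + ln (delta^-1)
                     + lil (mx_opnorm D / kappa))].
Proof.
move=> m0 d01 k0; have /andP[d0 d1] := d01.
have TR0 : 0 <= T%:R :> R by [].
have pt0 : 0 <= ptilde p T :> R by exact: ptilde_ge0.
pose dj (j : nat) := delta / (j.+1 * j.+2)%:R.
have dj01 j : 0 < dj j < 1.
  rewrite /dj divr_gt0 ?ltr0n//= ltr_pdivrMr ?ltr0n// mul1r.
  by apply: (lt_le_trans d1); rewrite ler1n.
have sp j : 0 < kappa * 2 ^+ j by rewrite mulr_gt0// exprn_gt0.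
have V0p j : mx_posdef (((kappa * 2 ^+ j) ^+ 2)%:M : 'M[R]_m).
  by apply: mx_posdef_scalar; rewrite exprn_gt0.
have /choice[E hE] := fun j => self_normalized_bound (dj01 j) (V0p j).
have [|||mE PE] := @countable_event_bound _ _ _ P E delta.
- exact: ltW.
- by move=> j; case: (hE j).
- by move=> j; case: (hE j).
exists (\bigcap_j E j); split => // w Ew /=.
set U := Ubar _ _ _ _ _ w; set D := Delta _ _ _ _ w.
have x0 : 0 <= mx_opnorm D by exact: mx_opnorm_ge0.
have [j [Dj sj lj]] := dyadic_scale k0 x0.
have [_ _ /(_ w (Ew j I)) [_ h]] := hE j.
rewrite -/U -/D in h.
have {}h := h _ _ (gram_factorE D (sp j)).
have del0 : 0 <= ln delta^-1 by rewrite ln_ge0// invf_ge1// ltW.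
have lil0 : 0 <= lil (mx_opnorm D / kappa) by rewrite lil_ge0// divr_ge0// ltW.
have ldet : ln (\det (1%:M + D *m invmx ((kappa * 2 ^+ j) ^+ 2)%:M *m D^T)) <= m%:R.
  have dle := ler_det_1D_gram (sp j) Dj.
  apply: (@le_trans _ _ (ln (2 ^+ m))).
    have [dp|dn] := ltP 0 (\det (1%:M + D *m invmx ((kappa * 2 ^+ j) ^+ 2)%:M *m D^T)).
      by rewrite ler_ln ?posrE ?exprn_gt0.
    by rewrite ln0// ln_ge0// exprn_ege1// ler1n.
  have ln2 : ln 2 <= 1 :> R by have := @le_ln1Dx R 1; apply; lra.
  by rewrite lnXn// -[leLHS]mulr_natr ler_piMl.
have ldj : ln (dj j)^-1 <= ln delta^-1 + (4 + 2 * lil (mx_opnorm D / kappa)).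
  rewrite /dj invf_div mulrC lnM ?posrE ?ltr0n ?invr_gt0//.
  by rewrite lerD2l.
have m1 : 1 <= m%:R :> R by rewrite ler1n.
set Y := ptilde p T + _ + _ + _.
have Y0 : 0 <= Y by rewrite /Y !addr_ge0.
rewrite [28 * _ * _]mulrAC; apply: sqrt_bound => //.
- exact: mx_opnorm_ge0.
- by rewrite mulr_ge0// addr_ge0// ltW.
apply: (le_trans (gram_factor_opnorm (sp j) (D^T *m U) Dj)).
apply: (@le_trans _ _ (2 * (2 * (mx_opnorm D + kappa)) ^+ 2 * (8 * T%:R * (12 * Y)))).
  apply: ler_pM; [by rewrite mulr_ge0 ?sqr_ge0|exact: sqr_ge0| |].
    rewrite ler_pM2l// lerXn2r ?nnegrE ?(ltW (sp j))//.
    by rewrite mulr_ge0// addr_ge0// ltW.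
  by apply: (le_trans h); rewrite ler_wpM2l ?mulr_ge0// /Y; lra.
have -> : 2 * (2 * (mx_opnorm D + kappa)) ^+ 2 * (8 * T%:R * (12 * Y)) =
    768 * ((mx_opnorm D + kappa) ^+ 2 * T%:R * Y) by ring.
have -> : (28 * (mx_opnorm D + kappa)) ^+ 2 * T%:R * Y =
    784 * ((mx_opnorm D + kappa) ^+ 2 * T%:R * Y) by ring.
by rewrite ler_wpM2r ?mulr_ge0 ?sqr_ge0//; lra.
Qed.

End Regression.

Theorem theorem5 (R : realType) :
  exists C : R, 0 < C /\
  forall (p m T N1 N : nat) (d : measure_display) (Omega : measurableType d)
    (P : probability Omega R) (F : int -> set (set Omega))
    (u : int -> Omega -> 'cV[R]_p) (dl : int -> Omega -> 'cV[R]_m),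
    (0 < p)%N -> (0 < m)%N -> (0 < T)%N -> (1 <= N1)%N -> (N1 <= N)%N ->
    filtration F ->
    (* u_t is F_t-measurable *)
    (forall t (l : 'I_p), measurable_wrt (F t) (fun w => u t w l 0)) ->
    (* u_t | F_{t-1} is mean zero *)
    (forall t (l : 'I_p), P.-integrable setT (fun w => (u t w l 0)%:E)) ->
    (forall t (l : 'I_p) (A : set Omega), F (t - 1) A ->
       (\int[P]_(w in A) (u t w l 0)%:E = 0)%E) ->
    (* u_t | F_{t-1} is 1-subgaussian:
       E[exp<v,u_t> | F_{t-1}] <= exp(|v|^2/2), i.e. for every A in F_{t-1},
       E[1_A exp<v,u_t>] <= P(A) exp(|v|^2/2) *)
    (forall t (v : 'cV[R]_p) (A : set Omega), F (t - 1) A ->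
       (\int[P]_(w in A) (expR (\sum_(l < p) v l 0 * u t w l 0))%:E
          <= P A * (expR (mx_norm2 v ^+ 2 / 2))%:E)%E) ->
    (* delta_t is F_{t-T}-measurable *)
    (forall t (j : 'I_m),
       measurable_wrt (F (t - T%:Z)) (fun w => dl t w j 0)) ->
    (* (a) *)
    (forall (delta : R) (V0 : 'M[R]_m), 0 < delta < 1 -> mx_posdef V0 ->
       exists E : set Omega, [/\ measurable E, (P E >= (1 - delta)%:E)%E &
         forall w, E w ->
           let U := Ubar p T N1 N u w in
           let D := Delta m N1 N dl w in
           mx_opnorm (invmx (mx_sqrtm (D^T *m D + V0)) *m (D^T *m U))
             <= C * Num.sqrt (T%:R) *
                Num.sqrt (ptilde p T + ln (delta^-1)
                  + ln (\det (1%:M + D *m invmx V0 *m D^T)) / 2)]) /\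
    (* (b) *)
    (forall (delta kappa : R), 0 < delta < 1 -> 0 < kappa ->
       exists E : set Omega, [/\ measurable E, (P E >= (1 - delta)%:E)%E &
         forall w, E w ->
           let U := Ubar p T N1 N u w in
           let D := Delta m N1 N dl w in
           mx_sigma_min U ^+ 2 * mx_opnorm (mx_pinv U *m D) <= mx_opnorm (D^T *m U) /\
           mx_opnorm (D^T *m U)
             <= C * Num.sqrt (T%:R) * (mx_opnorm D + kappa) *
                Num.sqrt (ptilde p T + m%:R + ln (delta^-1)
                          + lil (mx_opnorm D / kappa))]).
Proof.
exists 28; split; first by lra.
move=> p m T N1 N d Omega P F u dl p0 m0 T0 _ _ filF mu _ _ usub mdl.
split => [delta V0 d01 V0p|delta kappa d01 k0].
  exact: (whitened_cross_bound N1 N p0 T0 filF mu usub mdl m0 d01 V0p).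
have [E [mE PE hE]] := cross_bound N1 N p0 T0 filF mu usub mdl m0 d01 k0.
exists E; split => // w Ew U D; split; first exact: mx_pinv_bound.
exact: hE.
Qed.
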